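(* An elliptic curve $E$ over a field $K$ of characteristic $2$ has a $K$-rational point of order $4$ if and only if there exists a nonzero $\gamma\in K$ such that $E$ is $K$-isomorphic to the elliptic curve $$\mathbf{E}_{4,\gamma}: y^2+xy=x^3+\gamma^4.$$
   Context: The zero of the group law on $\mathbf{E}_{4,\gamma}$ is its point at infinity $(0:1:0)$. $K$-isomorphic means isomorphic over $K$ as elliptic curves. *)

(* Defs.v *)
From HB Require Import structures.
From mathcomp Require Import all_boot all_order all_algebra.
From mathcomp Require Import mpoly.

Set Implicit Arguments.
Unset Strict Implicit.
Unset Printing Implicit Defensive.

Import GRing.Theory.
Local Open Scope ring_scope.

(* The curve y^2 + a1 x y + a3 y = x^3 + a2 x^2 + a4 x + a6. *)
Record weierstrass (K : Type) := Weierstrass {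
  a1 : K; a2 : K; a3 : K; a4 : K; a6 : K }.

Definition iX : 'I_3 := @Ordinal 3 0 isT.
Definition iY : 'I_3 := @Ordinal 3 1 isT.
Definition iZ : 'I_3 := @Ordinal 3 2 isT.

Section Curves.
Variable K : fieldType.
Implicit Types (E : weierstrass K) (p : {mpoly K[3]}).

Definition weq E : {mpoly K[3]} :=
  let X := 'X_iX in let Y := 'X_iY in let Z := 'X_iZ in
  Y ^+ 2 * Z + (a1 E)%:MP * X * Y * Z + (a3 E)%:MP * Y * Z ^+ 2
  - (X ^+ 3 + (a2 E)%:MP * X ^+ 2 * Z + (a4 E)%:MP * X * Z ^+ 2
     + (a6 E)%:MP * Z ^+ 3).

(* Points of the projective plane over an extension f : K -> L are nonzero
   vectors of homogeneous coordinates; all notions below are invariant under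
   rescaling. *)
Definition nonzero (L : fieldType) (v : 'I_3 -> L) : Prop := exists i, v i != 0.

Definition evalx (L : fieldType) (f : {rmorphism K -> L}) p (v : 'I_3 -> L) : L :=
  (map_mpoly f p).@[v].

Definition geom_point (L : fieldType) (f : {rmorphism K -> L}) E
    (v : 'I_3 -> L) : Prop :=
  nonzero v /\ evalx f (weq E) v = 0.

(* Jacobian criterion at every point over every extension field; the zero is
   the point at infinity (0 : 1 : 0), which lies on every Weierstrass curve. *)
Definition elliptic E : Prop :=
  forall (L : fieldType) (f : {rmorphism K -> L}) (v : 'I_3 -> L),
    geom_point f E v -> exists i, evalx f (mderiv i (weq E)) v != 0.

(* K-rational points, in the chart Z = 1 together with (0 : 1 : 0). *)
Inductive point := Inf | Aff of K & K.

Definition on_curve E (P : point) : Prop :=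
  if P is Aff x y then
    y ^+ 2 + a1 E * x * y + a3 E * y
      = x ^+ 3 + a2 E * x ^+ 2 + a4 E * x + a6 E
  else True.

(* Chord-and-tangent law; l is the slope of the line through P and Q, and
   Q = -P is the case of a vertical line. *)
Definition padd E (P Q : point) : point :=
  match P, Q with
  | Inf, _ => Q
  | _, Inf => P
  | Aff x1 y1, Aff x2 y2 =>
    if (x1 == x2) && (y1 + y2 + a1 E * x2 + a3 E == 0) then Inf else
    let l :=
      if x1 == x2 then
        (x1 ^+ 2 *+ 3 + a2 E * x1 *+ 2 + a4 E - a1 E * y1)
          / (y1 *+ 2 + a1 E * x1 + a3 E)
      else (y2 - y1) / (x2 - x1) in
    let x3 := l ^+ 2 + a1 E * l - a2 E - x1 - x2 in
    Aff x3 (- (l * (x3 - x1) + y1) - a1 E * x3 - a3 E)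
  end.

Definition pmul E (n : nat) (P : point) : point := iter n (padd E P) Inf.

Definition has_order E (P : point) (n : nat) : Prop :=
  [/\ (0 < n)%N, pmul E n P = Inf
    & forall m, (0 < m < n)%N -> pmul E m P <> Inf].

(* p vanishes identically on E, i.e. is zero in K[X,Y,Z]/(weq E). *)
Definition vanishes E p : Prop := exists q, p = q * weq E.

(* A rational map from E to the projective plane, over K, is represented by
   three forms of the same degree, not all vanishing on E. *)
Definition form_triple E (phi : 3.-tuple {mpoly K[3]}) : Prop :=
  (exists d, forall i, tnth phi i \is d.-homog)
  /\ (exists i, ~ vanishes E (tnth phi i)).

Definition same_rmap E (phi psi : 3.-tuple {mpoly K[3]}) : Prop :=
  forall i j, vanishes E (tnth phi i * tnth psi j - tnth phi j * tnth psi i).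

(* The rational map represented by phi is regular at v, with value w: some
   representative psi does not vanish at v, and psi(v) is proportional to w. *)
Definition rmap_at (L : fieldType) (f : {rmorphism K -> L}) E
    (phi : 3.-tuple {mpoly K[3]}) (v w : 'I_3 -> L) : Prop :=
  nonzero w /\
  exists psi, [/\ form_triple E psi, same_rmap E phi psi
    & exists2 c, c != 0 & forall i, evalx f (tnth psi i) v = c * w i].

Definition morphism E E' (phi : 3.-tuple {mpoly K[3]}) : Prop :=
  [/\ form_triple E phi,
      vanishes E (weq E' \mPo phi)
    & forall (L : fieldType) (f : {rmorphism K -> L}) (v : 'I_3 -> L),
        geom_point f E v -> exists w, rmap_at f E phi v w].

Definition rcomp (chi phi : 3.-tuple {mpoly K[3]}) : 3.-tuple {mpoly K[3]} :=
  [tuple tnth chi i \mPo phi | i < 3].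

Definition rid : 3.-tuple {mpoly K[3]} := [tuple 'X_i | i < 3].

Definition is_identity E (phi : 3.-tuple {mpoly K[3]}) : Prop :=
  form_triple E phi /\ same_rmap E phi rid.

Definition zero_pt : 'I_3 -> K := fun i => (i == iY)%:R.

(* Isomorphism over K of projective curves, mapping the zero to the zero. *)
Definition K_isomorphic E E' : Prop :=
  exists phi chi,
    [/\ morphism E E' phi, morphism E' E chi,
        is_identity E (rcomp chi phi), is_identity E' (rcomp phi chi)
      & rmap_at (idfun : {rmorphism K -> K}) E phi zero_pt zero_pt].

Definition E4 (gamma : K) : weierstrass K := Weierstrass 1 0 0 0 (gamma ^+ 4).

End Curves.

Arguments Inf {K}.

(* Main.v *)
From HB Require Import structures.
From mathcomp Require Import all_boot all_order all_algebra all_field.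
From mathcomp Require Import boolp classical_sets.
From mathcomp Require Import mpoly generic_quotient ring_quotient ring zify.
Require Import Defs.

(** If 2P = T has order 2, the tangent at P and the line through P and T show
    that the coordinates in which T has abscissa 0 and the tangent at P is
    horizontal turn the equation into that of [E4 g], P becoming [(g, g^2)];
    this is [model] below, and in characteristic 2 the computation reverses.

    What remains is that an abstract isomorphism E -> [E4 g] is such a change
    of coordinates. Write A for the affine coordinate ring. The denominators of
    the pulled back coordinates x', y' form an ideal of A; if it were proper, a
    maximal ideal above it would give a point of E over a residue field, away
    from infinity, which is sent to infinity, and the inverse map would send it
    back to the point at infinity of E. So x' and y' lie in A, and by symmetry
    they generate A. The order of the pole at infinity is a degree function on
    A with value 2i + 3j at [x^i y^j]; the equation of [E4 g] gives x' and y'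
    pole orders 2k and 3k, all pole orders on A are then multiples of k, and so
    k = 1. Hence x' is affine in x and y' is affine in x and y, and the equation
    of E is read off because the generic point satisfies only one Weierstrass
    equation. *)

Set Implicit Arguments.
Unset Strict Implicit.
Unset Printing Implicit Defensive.

Import GRing.Theory.
Local Open Scope ring_scope.

(** * Residue fields of maximal ideals *)

Section ResidueField.
Variables (R : comNzRingType) (J : set R).
Hypothesis J0 : J 0.
Hypothesis JD : forall a b, J a -> J b -> J (a + b).
Hypothesis JM : forall a b, J b -> J (a * b).
Hypothesis J1 : ~ J 1.
Hypothesis Jmax : forall a, ~ J a -> exists b, J (b * a - 1).

Definition ideal_pred : pred R := fun a => `[< J a >].

Lemma ideal_pred_closed : idealr_closed ideal_pred.
Proof.
split; [exact/asboolP|exact/asboolP|].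
move=> a u v /asboolP Ju /asboolP Jv; apply/asboolP.
by apply: JD => //; apply: JM.
Qed.

HB.instance Definition _ := isIdealr.Build R ideal_pred ideal_pred_closed.

Definition residue_ideal : idealr R := ideal_pred.
Definition residue := {ideal_quot residue_ideal}.
HB.instance Definition _ := GRing.ComNzRing.on residue.

Definition to_residue : R -> residue := \pi%qT.

Lemma to_residue_eq0 a : to_residue a = 0 <-> J a.
Proof.
have e : (to_residue a == 0) = ideal_pred a.
  by rewrite /to_residue piE Quotient.equivE subr0.
by split=> [/eqP|Ja]; [|apply/eqP]; rewrite e => *; apply/asboolP.
Qed.

Lemma to_residue_zmod : zmod_morphism to_residue.
Proof. by move=> a b; rewrite /to_residue !piE. Qed.

Lemma to_residue_monoid : monoid_morphism to_residue.
Proof. by split=> [|a b]; rewrite /to_residue !piE. Qed.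

HB.instance Definition _ :=
  GRing.isZmodMorphism.Build R residue to_residue to_residue_zmod.
HB.instance Definition _ :=
  GRing.isMonoidMorphism.Build R residue to_residue to_residue_monoid.

Lemma residue_has_inv (q : residue) : exists r, q != 0 -> r * q = 1.
Proof.
case: (eqVneq q 0) => [_|q0]; first by exists 0.
rewrite -(reprK q) -/(to_residue _) in q0 *.
have /Jmax [b Jb] : ~ J (repr q) by move/to_residue_eq0/eqP; apply/negP.
exists (to_residue b) => _; move/to_residue_eq0: Jb.
by rewrite rmorphB rmorphM rmorph1 => /eqP; rewrite subr_eq0 => /eqP.
Qed.

Definition residue_inv (q : residue) : residue :=
  if q == 0 then 0 else xget 0 (fun r => r * q = 1).

Lemma residue_mulVf q : q != 0 -> residue_inv q * q = 1.
Proof.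
move=> q0; rewrite /residue_inv (negPf q0).
by case: xgetP => [//|noinv]; case: (residue_has_inv q) => r /(_ q0)/noinv.
Qed.

Lemma residue_inv0 : residue_inv 0 = 0.
Proof. by rewrite /residue_inv eqxx. Qed.

HB.instance Definition _ :=
  GRing.ComNzRing_isField.Build residue residue_mulVf residue_inv0.

Lemma residue_field : exists (L : fieldType) (g : {rmorphism R -> L}),
  forall a, J a -> g a = 0.
Proof. by exists residue, to_residue => a /to_residue_eq0. Qed.

End ResidueField.

Lemma proper_ideal_residue (R : comNzRingType) (I : set R) :
    I 0 -> (forall a b, I a -> I b -> I (a + b)) ->
    (forall a b, I b -> I (a * b)) -> ~ I 1 ->
  exists (L : fieldType) (g : {rmorphism R -> L}), forall a, I a -> g a = 0.
Proof.
move=> I0 ID IM I1.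
(* Containing I is asked only of a nonempty J, so that the empty set, the union of the empty chain,
   also qualifies for Zorn's lemma. *)
pose ok (J : set R) := [/\ forall a b, J a -> J b -> J (a + b),
  forall a b, J b -> J (a * b), ~ J 1 & forall a, J a -> (I `<=` J)%classic].
have [|J [[JD JM J1 JI] Jmax]] := @Zorn_bigcup R ok.
  move=> F Fok Ftot; split=> [a b [A FA Aa] [B FB Bb]|a b [B FB Bb]|[A FA]|a [A FA Aa] b Ib].
  - have [AB|BA] := Ftot A B FA FB.
      by exists B => //; case: (Fok B FB) => BD _ _ _; apply: BD => //; apply: AB.
    by exists A => //; case: (Fok A FA) => AD _ _ _; apply: AD => //; apply: BA.
  - by exists B => //; case: (Fok B FB) => _ BM _ _; apply: BM.
  - by case: (Fok A FA).
  - by exists A => //; case: (Fok A FA) => _ _ _ /(_ a Aa); apply.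
(* The maximal J is not empty, since I itself would then be a larger admissible set. *)
have IJ : (I `<=` J)%classic.
  have [[a /JI//]|J0] := pselect (exists a, J a).
  have ltJI : (J `<` I)%classic.
    by split=> [a Ja|IJ]; case: J0; [exists a|exists 0; apply: IJ].
  by case: (Jmax I ltJI); split=> // a _.
have J0 := IJ _ I0.
suff /(residue_field J0 JD JM J1) [L [g gJ]] :
    forall a, ~ J a -> exists b, J (b * a - 1) by exists L, g => a /IJ/gJ.
move=> a nJa.
(* The ideal generated by J and a: either it contains 1, which inverts a modulo J, or it contradicts
   maximality. *)
pose B : set R := fun c => exists j b, J j /\ c = j + b * a.
have [[j [b [Jj e]]]|B1] := pselect (B 1).
  by exists b; rewrite e opprD addrCA subrr addr0 -mulN1r; apply: JM.
have ltJB : (J `<` B)%classic.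
  split=> [j Jj|BJ]; first by exists j, 0; rewrite mul0r addr0.
  by apply/nJa/BJ; exists 0, 1; rewrite mul1r add0r.
case: (Jmax B ltJB).
split=> // [_ _ [j [b [Jj ->]]] [k [c [Jk ->]]]|c _ [j [b [Jj ->]]]|_ _ c Ic].
- by exists (j + k), (b + c); split; [apply: JD|ring].
- by exists (c * j), (c * b); split; [apply: JM|ring].
- by exists c, 0; split; [apply: IJ|ring].
Qed.

(** * Evaluation of forms at points *)

Section Evaluation.
Variables (K L : fieldType) (f : {rmorphism K -> L}).
Implicit Types (p q : {mpoly K[3]}) (v : 'I_3 -> L).

Definition eval_at v p := evalx f p v.

Lemma eval_at_zmod v : zmod_morphism (eval_at v).
Proof. by move=> p q; rewrite /eval_at /evalx rmorphB mevalB. Qed.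

Lemma eval_at_monoid v : monoid_morphism (eval_at v).
Proof.
by split=> [|p q]; rewrite /eval_at /evalx ?(rmorph1, rmorphM) ?meval1 ?mevalM.
Qed.

HB.instance Definition _ v :=
  GRing.isZmodMorphism.Build {mpoly K[3]} L (eval_at v) (eval_at_zmod v).
HB.instance Definition _ v :=
  GRing.isMonoidMorphism.Build {mpoly K[3]} L (eval_at v) (eval_at_monoid v).

Lemma evalxC v c : evalx f c%:MP v = f c.
Proof. by rewrite /evalx map_mpolyC mevalC. Qed.

Lemma evalxX v i : evalx f 'X_i v = v i.
Proof. by rewrite /evalx map_mpolyX mevalXU. Qed.

Lemma evalxB v p q : evalx f (p - q) v = evalx f p v - evalx f q v.
Proof. exact: (rmorphB (eval_at v)). Qed.

Lemma evalxM v p q : evalx f (p * q) v = evalx f p v * evalx f q v.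
Proof. exact: (rmorphM (eval_at v)). Qed.

Lemma eq_evalx v w p : v =1 w -> evalx f p v = evalx f p w.
Proof. exact: meval_eq. Qed.

Lemma morph_evalx (h : {rmorphism {mpoly K[3]} -> L}) v :
    (forall c, h c%:MP = f c) -> (forall i, h 'X_i = v i) ->
  forall p, h p = evalx f p v.
Proof.
move=> hC hX p; rewrite -[RHS]/(eval_at v p) [p]mpolyE !rmorph_sum /=.
apply: eq_bigr => m _; rewrite -mul_mpolyC !rmorphM /= hC.
rewrite [eval_at v _%:MP]evalxC; congr (_ * _).
rewrite mpolyXE_id !rmorph_prod /=; apply: eq_bigr => i _.
by rewrite !rmorphXn /= hX [eval_at v _]evalxX.
Qed.

Lemma evalx_comp p lq v :
  evalx f (p \mPo lq) v = evalx f p (fun i => evalx f (tnth lq i) v).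
Proof.
pose h : {rmorphism _ -> _} := eval_at v \o comp_mpoly lq.
apply: (morph_evalx (h := h)) => [c|i] /=; first by rewrite comp_mpolyC [LHS]evalxC.
by rewrite comp_mpolyXU -tnth_nth.
Qed.

Lemma evalx_scale d p c v :
  p \is d.-homog -> evalx f p (fun i => c * v i) = c ^+ d * evalx f p v.
Proof.
move=> /dhomogP ph; rewrite -![evalx _ _ _]/(eval_at _ p) [p]mpolyE !rmorph_sum /=.
rewrite mulr_sumr !big_seq; apply: eq_bigr => m /ph md.
rewrite -mul_mpolyC !rmorphM /= ![eval_at _ _%:MP]evalxC mulrCA; congr (_ * _).
rewrite mpolyXE_id !rmorph_prod /= -md /= mdegE expr_sum -big_split /=.
by apply: eq_bigr => i _; rewrite !rmorphXn /= ![eval_at _ _]evalxX exprMn.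
Qed.

End Evaluation.

Lemma rmorph_evalx (K L M : fieldType) (f : {rmorphism K -> L})
    (g : {rmorphism L -> M}) p (v : 'I_3 -> L) :
  g (evalx f p v) = evalx (g \o f) p (fun i => g (v i)).
Proof.
pose h : {rmorphism _ -> _} := g \o eval_at f v.
apply: (morph_evalx (f := g \o f) (h := h)) => [c|i] /=.
  by congr (g _); exact: evalxC.
by congr (g _); exact: evalxX.
Qed.

Lemma dhomog_comp (K : fieldType) (p : {mpoly K[3]}) (lq : 3.-tuple {mpoly K[3]}) d e :
    p \is d.-homog -> (forall i, tnth lq i \is e.-homog) ->
  p \mPo lq \is (e * d).-homog.
Proof.
move=> /dhomogP ph qh; rewrite comp_mpolyEX big_seq rpred_sum // => m /ph md.
apply: rpredZ; rewrite comp_mpolyX -md /= mdegE big_distrr /=.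
elim/big_rec2: _ => [|i a b _ IH]; first exact: dhomog1.
by apply: dhomogM IH; apply: dhomogMn.
Qed.

Section Weierstrass.
Variables (K : fieldType) (E : weierstrass K).

Definition weq_at (L : fieldType) (f : {rmorphism K -> L}) (x y z : L) :=
  y ^+ 2 * z + f (a1 E) * x * y * z + f (a3 E) * y * z ^+ 2
  - (x ^+ 3 + f (a2 E) * x ^+ 2 * z + f (a4 E) * x * z ^+ 2 + f (a6 E) * z ^+ 3).

Lemma evalx_weq (L : fieldType) (f : {rmorphism K -> L}) v :
  evalx f (weq E) v = weq_at f (v iX) (v iY) (v iZ).
Proof.
rewrite -[LHS]/(eval_at f v _) /weq /weq_at !(rmorphB, rmorphD, rmorphM, rmorphXn) /=.
by rewrite ![eval_at f v _%:MP]evalxC ![eval_at f v 'X__]evalxX.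
Qed.

Lemma vanishes_eval (L : fieldType) (f : {rmorphism K -> L}) p v :
  vanishes E p -> evalx f (weq E) v = 0 -> evalx f p v = 0.
Proof. by case=> q -> e; rewrite evalxM e mulr0. Qed.

End Weierstrass.

(** * The affine coordinate ring and the generic point *)

(* The type argument of [size] appears in convertible but syntactically distinct
   forms; [simpl] makes them agree. *)
Ltac slia := simpl in *; lia.

Section CoordinateRing.
Variables (K : fieldType) (E : weierstrass K).
Implicit Types (P Q : {poly K}).

Definition ylin : {poly K} := (a1 E)%:P * 'X + (a3 E)%:P.
Definition ycub : {poly K} :=
  'X^3 + (a2 E)%:P * 'X^2 + (a4 E)%:P * 'X + (a6 E)%:P.

(** The norm of P + Q y down to K[x]: its product with the conjugate P - Q (y + [ylin]), where y^2 +
    [ylin] y = [ycub] on the curve. *)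
Definition norm P Q := P ^+ 2 - ylin * P * Q - ycub * Q ^+ 2.

Lemma norm_mul P Q P' Q' :
  norm (P * P' + ycub * Q * Q') (P * Q' + Q * P' - ylin * Q * Q')
  = norm P Q * norm P' Q'.
Proof. by rewrite /norm; ring. Qed.

Lemma size_ycub : size ycub = 4.
Proof.
have -> : ycub = Poly [:: a6 E; a4 E; a2 E; 1].
  by rewrite /ycub /= !cons_poly_def; ring.
by rewrite (@PolyK _ 0) //= oner_eq0.
Qed.

Lemma ycub_monic : ycub \is monic.
Proof.
have -> : ycub = Poly [:: a6 E; a4 E; a2 E; 1].
  by rewrite /ycub /= !cons_poly_def; ring.
by rewrite monicE lead_coefE (@PolyK _ 0) //= oner_eq0.
Qed.

Lemma size_ylin : (size ylin <= 2)%N.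
Proof.
have -> : ylin = Poly [:: a3 E; a1 E].
  by rewrite /ylin /= !cons_poly_def; ring.
exact: size_Poly.
Qed.

(** Two more than the pole order of P + Q y at infinity, x having order 2 and y order 3; the shift
    leaves the value 0 for the zero function. *)
Definition weight P Q :=
  maxn (size P).*2 (if Q == 0 then 0%N else ((size Q).*2 + 3)%N).

(** The degrees of P^2 and [ycub] Q^2 have different parity, so their leading terms cannot cancel,
    and the cross term has degree below the larger of the two. *)
Lemma size_norm P Q : size (norm P Q) = (weight P Q).-1.
Proof.
have sqr (R : {poly K}) : size (R ^+ 2) = (size R).*2.-1.
  have [->|R0] := eqVneq R 0; first by rewrite expr0n size_poly0.
  by rewrite expr2 size_mul // addnn.
rewrite /norm /weight.
have [->|Q0] := eqVneq Q 0; first by rewrite mulr0 expr0n mulr0 !subr0 sqr maxn0.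
have sQ : size (ycub * Q ^+ 2) = ((size Q).*2 + 2)%N.
  rewrite size_monicM ?ycub_monic // ?expf_neq0 // size_ycub sqr.
  by move: Q0; rewrite -size_poly_gt0; slia.
have [->|P0] := eqVneq P 0.
  rewrite !(mulr0, mul0r) expr0n subr0 sub0r size_polyN sQ size_poly0 double0 max0n.
  by rewrite addn3 addn2.
have sM : (size (ylin * P * Q)%R <= size P + size Q)%N.
  apply: leq_trans (size_polyMleq _ _) _.
  have := size_polyMleq ylin P; have := size_ylin.
  by move: P0 Q0; rewrite -!size_poly_gt0; slia.
move: P0 Q0; rewrite -!size_poly_gt0 => P0 Q0.
have [lt|ge] := ltnP (size Q).+1 (size P).
  rewrite -addrA size_polyDl sqr; first by slia.
  apply: leq_ltn_trans (size_polyD _ _) _; rewrite !size_polyN sQ.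
  by rewrite gtn_max (leq_ltn_trans sM) /=; slia.
rewrite addrC size_polyDl size_polyN sQ; first by slia.
apply: leq_ltn_trans (size_polyD _ _) _; rewrite size_polyN sqr.
by rewrite gtn_max (leq_ltn_trans sM) /=; slia.
Qed.

Lemma norm_eq0 P Q : norm P Q = 0 -> P = 0 /\ Q = 0.
Proof.
move/(congr1 (fun R : {poly K} => size R)); rewrite size_norm size_poly0 /weight.
have [->|Q0] := eqVneq Q 0; last by slia.
by split=> //; apply/eqP; rewrite -size_poly_leq0; slia.
Qed.

Lemma horner_ylin (L : fieldType) (f : {rmorphism K -> L}) x :
  (map_poly f ylin).[x] = f (a1 E) * x + f (a3 E).
Proof. by rewrite /ylin !(rmorphD, rmorphM) /= !map_polyC map_polyX !hornerE. Qed.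

Lemma horner_ycub (L : fieldType) (f : {rmorphism K -> L}) x :
  (map_poly f ycub).[x] = x ^+ 3 + f (a2 E) * x ^+ 2 + f (a4 E) * x + f (a6 E).
Proof.
rewrite /ycub !(rmorphD, rmorphM) /= !map_polyC !map_polyX !hornerE.
by rewrite /=; ring.
Qed.

Definition affine_point (L : fieldType) (f : {rmorphism K -> L}) v :=
  v iZ = 1 /\ evalx f (weq E) v = 0.

Definition reduced (L : fieldType) (f : {rmorphism K -> L}) (v : 'I_3 -> L) P Q :=
  (map_poly f P).[v iX] + (map_poly f Q).[v iX] * v iY.

Lemma affine_point_sqr (L : fieldType) (f : {rmorphism K -> L}) v : affine_point f v ->
  v iY ^+ 2 = (map_poly f ycub).[v iX] - (map_poly f ylin).[v iX] * v iY.
Proof.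
case=> z1; rewrite evalx_weq /weq_at z1 => e.
apply/eqP; rewrite horner_ycub horner_ylin -subr_eq0 -[X in _ == X]e; apply/eqP.
by ring.
Qed.

Lemma formM (L : fieldType) (f : {rmorphism K -> L}) v P Q P' Q' : affine_point f v ->
  reduced f v P Q * reduced f v P' Q'
  = reduced f v (P * P' + ycub * Q * Q') (P * Q' + Q * P' - ylin * Q * Q').
Proof.
move/affine_point_sqr; move: ycub ylin => c l e; rewrite /reduced !(rmorphB, rmorphD, rmorphM) /=.
by rewrite !(hornerD, hornerN, hornerM); ring: e.
Qed.

(** Powers of y are eliminated by the equation. P and Q depend neither on the point nor on the
    field, which lets identities pass from the generic point to any affine point. *)
Lemma affine_form p : exists P Q, forall (L : fieldType) (f : {rmorphism K -> L}) v,
  affine_point f v -> evalx f p v = reduced f v P Q.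
Proof.
pose ok q := exists P Q, forall (L : fieldType) (f : {rmorphism K -> L}) v,
  affine_point f v -> evalx f q v = reduced f v P Q.
have okC c : ok c%:MP.
  exists c%:P, 0 => L f v _.
  by rewrite evalxC /reduced map_polyC map_poly0 !hornerE /=.
have okM q r : ok q -> ok r -> ok (q * r).
  move=> [P [Q e]] [P' [Q' e']].
  exists (P * P' + ycub * Q * Q'), (P * Q' + Q * P' - ylin * Q * Q') => L f v Ev.
  by rewrite evalxM e // e' // formM.
have okX i : ok 'X_i.
  have [->|[->|->]] : i = iX \/ i = iY \/ i = iZ.
    by case: i => [[|[|[|//]]] i3]; [left|right; left|right; right]; apply: val_inj.
  - by exists 'X, 0 => L f v _; rewrite evalxX /reduced map_polyX map_poly0 !hornerE.
  - by exists 0, 1 => L f v _; rewrite evalxX /reduced rmorph1 map_poly0 !hornerE.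
  - exists 1, 0 => L f v [z1 _].
    by rewrite evalxX /reduced rmorph1 map_poly0 !hornerE.
rewrite -/(ok p) [p]mpolyE; elim/big_ind: _ => [|q r [P [Q e]] [P' [Q' e']]|m _].
- exact: okC 0.
- exists (P + P'), (Q + Q') => L f v Ev.
  rewrite -[evalx _ _ _]/(eval_at f v _) rmorphD /= ![eval_at _ _ _]e ?[eval_at _ _ _]e' //.
  by rewrite /reduced !rmorphD /= !hornerD; ring.
- rewrite -mul_mpolyC mpolyXE_id; apply: (okM) => //.
  elim/big_ind: _ => [||i _]; [exact: okC 1|exact: okM|].
  elim: (m i) => [|n IH]; first exact: okC 1.
  by rewrite exprS; apply: (okM).
Qed.

(** Evaluation at such a v embeds the affine coordinate ring in F: 1 and y remain independent over
    K[x]. *)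
Definition generic_point (F : fieldType) (f : {rmorphism K -> F}) v :=
  affine_point f v /\ forall P Q, reduced f v P Q = 0 -> P = 0 /\ Q = 0.

End CoordinateRing.

(** In degree at most 3 a polynomial without a root is irreducible, so a root can be adjoined. *)
Lemma root_extension (F : fieldType) (h : {poly F}) : (1 < size h <= 4)%N ->
  exists (L : fieldType) (g : {rmorphism F -> L}) y, root (map_poly g h) y.
Proof.
move=> sh; have [[y hy]|noroot] := pselect (exists y, root h y).
  by exists F, idfun, y; rewrite map_poly_id.
have [x|L _ [y hy _]] := irredp_FAdjoin (cubic_irreducible sh _).
  by apply/negP => hx; case: noroot; exists x.
by exists L, (in_alg L), y.
Qed.

Lemma quadratic_extension (F : fieldType) (b c : F) :
  exists (L : fieldType) (g : {rmorphism F -> L}) y, y ^+ 2 + g b * y - g c = 0.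
Proof.
pose h : {poly F} := Poly [:: - c; b; 1].
have hE : h = 'X * 'X + b%:P * 'X - c%:P.
  by rewrite /h /= !cons_poly_def rmorphN /=; ring.
have [|L [g [y]]] := @root_extension F h.
  by rewrite (@PolyK _ 0) //= oner_eq0.
rewrite hE => /rootP; rewrite !(rmorphB, rmorphD, rmorphM) /= !map_polyC map_polyX /=.
rewrite !(hornerD, hornerN, hornerM) !hornerC hornerX => e.
by exists L, g, y; rewrite expr2.
Qed.

(** Any root y of the quadratic over k serves: a relation P + Q y = 0 makes the norm vanish, hence P
    = Q = 0. *)
Lemma generic_point_over (K k : fieldType) (E : weierstrass K)
    (tok : {rmorphism {poly K} -> k}) : injective tok ->
  exists (F : fieldType) (f : {rmorphism K -> F}) v, generic_point E f v.
Proof.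
move=> tok_inj; have [L [g [y yeq]]] := quadratic_extension (tok (ylin E)) (tok (ycub E)).
pose f : {rmorphism K -> L} := g \o (tok \o polyC).
pose x := g (tok 'X).
have evf P : (map_poly f P).[x] = g (tok P).
  rewrite (_ : map_poly f P = map_poly g (map_poly tok (map_poly polyC P))).
    by rewrite !horner_map -/(P \Po 'X) comp_polyXr.
  by rewrite -!map_poly_comp.
exists L, f, (fun i => if i == iX then x else if i == iY then y else 1).
split; first split=> //.
  by rewrite evalx_weq /weq_at -[RHS]yeq -!evf horner_ylin horner_ycub /=; ring.
move=> P Q; rewrite -[reduced _ _ _ _]/((map_poly f P).[x] + (map_poly f Q).[x] * y) !evf => e.
apply: (@norm_eq0 _ E).
apply/tok_inj/(fmorph_inj g); rewrite !rmorph0.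
move: yeq; rewrite /norm; move: (ylin E) (ycub E) => l c yeq.
rewrite !(rmorphB, rmorphD, rmorphM, rmorphXn) /=.
(* The norm as element times conjugate, plus a multiple of the equation of y. *)
transitivity ((g (tok P) + g (tok Q) * y) * (g (tok P) - g (tok Q) * (y + g (tok l)))
   + (g (tok Q)) ^+ 2 * (y ^+ 2 + g (tok l) * y - g (tok c))).
  by ring.
by rewrite e yeq mul0r mulr0 addr0.
Qed.

Lemma generic_point_exists (K : fieldType) (E : weierstrass K) :
  exists (F : fieldType) (f : {rmorphism K -> F}) v, generic_point E f v.
Proof.
apply: (@generic_point_over K {fraction {poly K}} E (@FracField.tofrac {poly K})).
by move=> p q /eqP; rewrite tofrac_eq => /eqP.
Qed.

(** * Pole orders at infinity *)

Lemma weightE (K : fieldType) (P Q : {poly K}) :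
  weight P Q = maxn (size P).*2 ((size Q).*2 + (0 < size Q) * 3).
Proof.
by rewrite /weight size_poly_gt0; case: eqVneq => [->|_]; rewrite ?size_poly0.
Qed.

Lemma weightD_le (K : fieldType) (P Q P' Q' : {poly K}) :
  (weight (P + P') (Q + Q') <= maxn (weight P Q) (weight P' Q'))%N.
Proof.
rewrite !weightE; have := size_polyD P P'; have := size_polyD Q Q'.
set a := size (P + P'); set b := size (Q + Q'); slia.
Qed.

Lemma weightD_lt (K : fieldType) (P Q P' Q' : {poly K}) :
  (weight P Q < weight P' Q')%N -> weight (P + P') (Q + Q') = weight P' Q'.
Proof.
move=> lt; apply/eqP; rewrite eqn_leq; apply/andP; split.
  by apply: leq_trans (weightD_le _ _ _ _) _; rewrite geq_max (ltnW lt) leqnn.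
have wN : weight (- P) (- Q) = weight P Q by rewrite !weightE !size_polyN.
(* The upper bound applied to the sum minus its first summand gives the lower bound. *)
have := weightD_le (P + P') (Q + Q') (- P) (- Q).
rewrite ![_ + _ - _]addrAC !subrr !add0r wN; slia.
Qed.

Section Degree.
Variables (K F : fieldType) (E : weierstrass K) (f : {rmorphism K -> F}).
Variable v : 'I_3 -> F.
Hypothesis gen : generic_point E f v.

Local Notation red := (reduced f v).

(* The norm to [K[x]] turns the order of the pole at infinity into a degree. *)
Definition pole a n := exists P Q, a = red P Q /\ size (norm E P Q) = n.+1.

Lemma reducedD P Q P' Q' : red P Q + red P' Q' = red (P + P') (Q + Q').
Proof. by rewrite /reduced !rmorphD /= !hornerD; ring. Qed.

Lemma reducedB P Q P' Q' : red P Q - red P' Q' = red (P - P') (Q - Q').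
Proof. by rewrite /reduced !rmorphB /= !hornerD !hornerN; ring. Qed.

Lemma reduced_inj P Q P' Q' : red P Q = red P' Q' -> P = P' /\ Q = Q'.
Proof.
move=> e; have [|/eqP P0 /eqP Q0] := gen.2 (P - P') (Q - Q').
  by rewrite -reducedB e subrr.
by split; apply/eqP; rewrite -subr_eq0.
Qed.

Lemma reduced_pole P Q : red P Q = 0 \/ exists n, pole (red P Q) n.
Proof.
case e: (size (norm E P Q)) => [|n]; last by right; exists n, P, Q.
have [//|-> ->] := @norm_eq0 _ E P Q; first by apply/eqP; rewrite -size_poly_eq0 e.
by left; rewrite /reduced map_poly0 !hornerE.
Qed.

Lemma pole_neq0 a n : pole a n -> a != 0.
Proof.
case=> P [Q [-> s]]; apply/eqP => /gen.2 [P0 Q0]; move: s.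
by rewrite P0 Q0 /norm mulr0 expr0n mulr0 !subr0 size_poly0.
Qed.

Lemma pole_uniq a m n : pole a m -> pole a n -> m = n.
Proof.
case=> P [Q [-> s]] [P' [Q' [/reduced_inj [<- <-]]]].
by rewrite s => -[].
Qed.

Lemma poleM a b m n : pole a m -> pole b n -> pole (a * b) (m + n).
Proof.
move=> [P [Q [-> s]]] [P' [Q' [-> s']]].
exists (P * P' + ycub E * Q * Q'), (P * Q' + Q * P' - ylin E * Q * Q').
rewrite (formM _ _ _ _ gen.1) norm_mul size_mul -?size_poly_gt0 ?s ?s' //.
by split=> //; slia.
Qed.

Lemma poleW a n : pole a n -> exists P Q, a = red P Q /\ weight P Q = n.+2.
Proof.
case=> P [Q [-> s]]; exists P, Q; split=> //.
by move: s; rewrite size_norm; case: (weight P Q) => [|w] //= ->.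
Qed.

Lemma poleD_le a b m n : pole a m -> pole b n ->
  a + b = 0 \/ exists2 k, (k <= maxn m n)%N & pole (a + b) k.
Proof.
move=> /poleW [P [Q [-> s]]] /poleW [P' [Q' [-> s']]]; rewrite reducedD.
have := weightD_le P Q P' Q'; rewrite s s' => le.
have [|[k pk]] := reduced_pole (P + P') (Q + Q'); [by left|right].
exists k => //; have [P1 [Q1 [/reduced_inj [<- <-] e]]] := poleW pk.
by move: le; rewrite e; slia.
Qed.

Lemma poleD_lt a b m n : (m < n)%N -> pole a m -> pole b n -> pole (a + b) n.
Proof.
move=> lt /poleW [P [Q [-> s]]] /poleW [P' [Q' [-> s']]]; rewrite reducedD.
exists (P + P'), (Q + Q'); split=> //.
by rewrite size_norm weightD_lt ?s ?s'.
Qed.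

Lemma pole_const c : c != 0 -> pole (f c) 0.
Proof.
move=> c0; exists c%:P, 0; split; first by rewrite /reduced map_polyC map_poly0 !hornerE.
by rewrite /norm mulr0 expr0n mulr0 !subr0 expr2 -polyCM size_polyC mulf_neq0.
Qed.

(** In Horner's scheme the added constant has pole order 0 and the other term a positive one, so
    nothing cancels. *)
Lemma pole_horner z m P : pole z m -> (0 < m)%N -> P != 0 ->
  pole (map_poly f P).[z] (m * (size P).-1).
Proof.
move=> pz m0; elim/poly_ind: P => [|P c IH]; first by rewrite eqxx.
rewrite rmorphD rmorphM /= map_polyC map_polyX !hornerE.
have [->|P0] := eqVneq P 0.
  rewrite mul0r add0r map_poly0 horner0 mul0r add0r polyC_eq0 => c0.
  by rewrite size_polyC c0 muln0; apply: pole_const.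
move=> _; rewrite size_MXaddC (negPf P0) /=.
have pM : pole ((map_poly f P).[z] * z) (m * size P).
  have -> : (m * size P = m * (size P).-1 + m)%N.
    by rewrite -mulnSr prednK // size_poly_gt0.
  by apply: poleM => //; apply: IH.
have [->|c0] := eqVneq c 0; first by rewrite rmorph0 addr0.
rewrite addrC; apply: poleD_lt (pole_const c0) pM.
by rewrite muln_gt0 m0 size_poly_gt0.
Qed.

Lemma pole_X : pole (v iX) 2.
Proof.
exists 'X, 0; split; first by rewrite /reduced map_polyX map_poly0 !hornerE.
by rewrite size_norm weightE size_polyX size_poly0.
Qed.

Lemma pole_Y : pole (v iY) 3.
Proof.
exists 0, 1; split; first by rewrite /reduced rmorph1 map_poly0 !hornerE.
by rewrite size_norm weightE size_poly1 size_poly0.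
Qed.

Definition pole_in (S : nat -> Prop) a := a = 0 \/ exists2 n, S n & pole a n.

(** Functions of distinct pole orders cannot cancel. Disjoint sets of possible orders give this
    independence without the exact orders. *)
Lemma pole_inD S T a b : pole_in S a -> pole_in T b ->
    (forall m n, S m -> T n -> m <> n) ->
  pole_in (fun n => S n \/ T n) (a + b) /\ (a + b = 0 -> a = 0 /\ b = 0).
Proof.
move=> [->|[m Sm pa]].
  by move=> [->|[n Tn pb]] _; rewrite add0r; split=> //; [left|right; exists n => //; right].
move=> [->|[n Tn pb]] ST.
  by rewrite addr0; split=> //; right; exists m => //; left.
have [lt|lt|/ST] := ltngtP m n; last by move/(_ Sm Tn).
  have pab := poleD_lt lt pa pb; split; first by right; exists n => //; right.
  by move=> ab0; case/eqP: (pole_neq0 pab).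
have pab := poleD_lt lt pb pa; rewrite addrC; split; first by right; exists m => //; left.
by move=> ab0; case/eqP: (pole_neq0 pab).
Qed.

End Degree.

(** * Forms vanishing at the generic point *)

Section HomogeneousVanishing.
Variables (K : fieldType) (E : weierstrass K).

Local Notation X := ('X_iX : {mpoly K[3]}).
Local Notation Y := ('X_iY : {mpoly K[3]}).
Local Notation Z := ('X_iZ : {mpoly K[3]}).

Lemma big_ord3 (R : Type) (idx : R) (op : Monoid.law idx) (t : 'I_3 -> R) :
  \big[op/idx]_(i < 3) t i = op (op (t iX) (t iY)) (t iZ).
Proof.
rewrite !big_ord_recr big_ord0 /= Monoid.mul1m.
by congr (op (op (t _) (t _)) (t _)); apply: val_inj.
Qed.

(** The homogenization to degree d of x^i A(y), for A of degree at most d - i; higher coefficients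
    are dropped. *)
Definition hom_part d i (A : {poly K}) : {mpoly K[3]} :=
  \sum_(j < d.+1 - i) (A`_j)%:MP * (X ^+ i * Y ^+ j * Z ^+ (d - i - j)).

Lemma hom_partD d i A B : hom_part d i (A + B) = hom_part d i A + hom_part d i B.
Proof.
rewrite /hom_part -big_split /=; apply: eq_bigr => j _.
by rewrite coefD mpolyCD mulrDl.
Qed.

Lemma hom_partZ d i c A : hom_part d i (c *: A) = c%:MP * hom_part d i A.
Proof.
rewrite /hom_part mulr_sumr; apply: eq_bigr => j _.
by rewrite coefZ mpolyCM -mulrA.
Qed.

Lemma hom_part0 d i : hom_part d i 0 = 0.
Proof. by rewrite /hom_part big1 // => j _; rewrite coef0 mpolyC0 mul0r. Qed.

Lemma hom_partXn d i j : (i + j <= d)%N ->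
  hom_part d i 'X^j = X ^+ i * Y ^+ j * Z ^+ (d - i - j).
Proof.
move=> ijd; have jb : (j < d.+1 - i)%N by lia.
rewrite /hom_part (bigD1 (Ordinal jb)) //= coefXn eqxx mpolyC1 mul1r.
rewrite big1 ?addr0 // => k; rewrite -val_eqE /= => kj.
by rewrite coefXn (negPf kj) mpolyC0 mul0r.
Qed.

Lemma evalx_hom_part (L : fieldType) (f : {rmorphism K -> L}) (v : 'I_3 -> L) d i
    (A : {poly K}) :
    v iZ = 1 -> (size A <= d.+1 - i)%N ->
  evalx f (hom_part d i A) v = v iX ^+ i * (map_poly f A).[v iY].
Proof.
move=> z1 sA; rewrite -[LHS]/(eval_at f v _) rmorph_sum /=.
rewrite (@horner_coef_wide _ (d.+1 - i)); last by rewrite size_map_poly.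
rewrite mulr_sumr; apply: eq_bigr => j _.
rewrite coef_map /= !rmorphM !rmorphXn /= [eval_at f v _%:MP]evalxC.
by rewrite ![eval_at f v 'X__]evalxX z1 expr1n; ring.
Qed.

(** Division by [weq E] as a cubic in X. The coefficient of X^3 is -1 whereas that of Y^2 is Z, so
    the remainders x^i A(y) with i < 3, unlike P + Q y, are reached within degree d. *)
Definition reducible d (p : {mpoly K[3]}) := exists q A0 A1 A2,
  [/\ (size (A0 : {poly K}) <= d.+1)%N, (size (A1 : {poly K}) <= d.+1 - 1)%N,
    (size (A2 : {poly K}) <= d.+1 - 2)%N
  & p = q * weq E + (hom_part d 0 A0 + hom_part d 1 A1 + hom_part d 2 A2)].

Lemma reducibleD d p p' : reducible d p -> reducible d p' -> reducible d (p + p').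
Proof.
move=> [q [A0 [A1 [A2 [s0 s1 s2 ->]]]]] [q' [B0 [B1 [B2 [t0 t1 t2 ->]]]]].
exists (q + q'), (A0 + B0), (A1 + B1), (A2 + B2).
by split; rewrite ?hom_partD; [..|ring];
  apply: leq_trans (size_polyD _ _) _; rewrite geq_max; apply/andP.
Qed.

Lemma reducibleZ d c p : reducible d p -> reducible d (c%:MP * p).
Proof.
move=> [q [A0 [A1 [A2 [s0 s1 s2 ->]]]]].
exists (c%:MP * q), (c *: A0), (c *: A1), (c *: A2).
by split; rewrite ?hom_partZ; [..|ring]; apply: leq_trans (size_scale_leq _ _) _.
Qed.

Lemma reducible_weq d q p : reducible d p -> reducible d (q * weq E + p).
Proof.
move=> [q' [A0 [A1 [A2 [s0 s1 s2 ->]]]]].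
by exists (q + q'), A0, A1, A2; split=> //; ring.
Qed.

Lemma reducible_monomial i j k : reducible (i + j + k) (X ^+ i * Y ^+ j * Z ^+ k).
Proof.
have [n] := ubnP i; elim: n => // n IH in i j k *; rewrite ltnS => lt_in.
have kE : k = (i + j + k - i - j)%N by lia.
have [i3|i3] := ltnP i 3.
  rewrite [in Z ^+ k]kE -hom_partXn; last by lia.
  move: i3 => {lt_in kE}.
  case: i => [|[|[|//]]] _; [exists 0, 'X^j, 0, 0|exists 0, 0, 'X^j, 0|exists 0, 0, 0, 'X^j];
    by rewrite !size_polyXn !size_poly0 !hom_part0; split; [lia..|ring].
(* The multiple q of [weq E] removes X^(h+3); every monomial left has a smaller power of X. *)
have {i3} [h ih] : exists h, i = (h + 3)%N by exists (i - 3)%N; lia.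
pose q := - (X ^+ h * Y ^+ j * Z ^+ k).
have -> : X ^+ i * Y ^+ j * Z ^+ k = q * weq E + (
   X ^+ h * Y ^+ (j + 2) * Z ^+ k.+1
   + ((a1 E)%:MP * (X ^+ h.+1 * Y ^+ j.+1 * Z ^+ k.+1)
   + ((a3 E)%:MP * (X ^+ h * Y ^+ j.+1 * Z ^+ (k + 2))
   + ((- a2 E)%:MP * (X ^+ (h + 2) * Y ^+ j * Z ^+ k.+1)
   + ((- a4 E)%:MP * (X ^+ h.+1 * Y ^+ j * Z ^+ (k + 2))
   + (- a6 E)%:MP * (X ^+ h * Y ^+ j * Z ^+ (k + 3))))))).
  by rewrite ih /q /weq !mpolyCN !exprD !exprS; ring.
have step a b c : (a < i)%N -> (a + b + c = i + j + k)%N ->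
    reducible (i + j + k) (X ^+ a * Y ^+ b * Z ^+ c).
  by move=> ai <-; apply: IH; lia.
apply: reducible_weq; apply: reducibleD; first by apply: step; lia.
do 4?[apply: reducibleD; first by apply/reducibleZ/step; lia].
by apply/reducibleZ/step; lia.
Qed.

Lemma dhomog_reducible d p : p \is d.-homog -> reducible d p.
Proof.
move=> /dhomogP ph; rewrite [p]mpolyE big_seq.
elim/big_ind: _ => [||m /ph md]; first by
  exists 0, 0, 0, 0; rewrite !size_poly0 !hom_part0; split=> //; ring.
  exact: reducibleD.
rewrite -mul_mpolyC; apply: reducibleZ.
have -> : d = (m iX + m iY + m iZ)%N by rewrite -md /= mdegE big_ord3.
rewrite mpolyXE_id big_ord3 /=; exact: reducible_monomial.
Qed.

(** The remainder is a sum of terms x^r A(y) with r = 0, 1, 2, whose pole orders are congruent to 2r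
    modulo 3. They cannot cancel, so a zero sum makes each A zero and p a multiple of [weq E]. *)
Lemma dhomog_vanishes (F : fieldType) (f : {rmorphism K -> F}) v d p :
  generic_point E f v -> p \is d.-homog -> evalx f p v = 0 -> vanishes E p.
Proof.
move=> gen /dhomog_reducible [q [A0 [A1 [A2 [s0 s1 s2 ->]]]]].
have [z1 Ev] := gen.1; rewrite -[evalx _ _ _]/(eval_at f v _) !rmorphD rmorphM /=.
rewrite [eval_at f v (weq E)]Ev mulr0 add0r ![eval_at f v _]evalx_hom_part //.
pose S r n := (n %% 3 = r)%N.
have pin r (A : {poly K}) : pole_in E f v (S ((2 * r) %% 3)%N) (v iX ^+ r * (map_poly f A).[v iY]).
  have [->|A0'] := eqVneq A 0; first by left; rewrite map_poly0 horner0 mulr0.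
  right; exists (2 * r + 3 * (size A).-1)%N; first by rewrite /S; lia.
  apply: (poleM gen _ (pole_horner gen (pole_Y E f v) _ A0')) => //.
  elim: r => [|r IH]; first by rewrite expr0 -[1](rmorph1 f); apply: pole_const; rewrite oner_eq0.
  by rewrite mulnS exprS; apply: (poleM gen (pole_X E f v) IH).
have [|/= p01 z01] := pole_inD gen (pin 0%N A0) (pin 1%N A1).
  by rewrite /S; lia.
have [|/= _ z012] := pole_inD gen p01 (pin 2%N A2).
  by rewrite /S; lia.
case/z012 => /z01 [e0 e1] e2.
have nil r (A : {poly K}) : v iX ^+ r * (map_poly f A).[v iY] = 0 -> A = 0.
  move=> e; apply/eqP/contraT => A0'; have := pole_horner gen (pole_Y E f v) _ A0'.
  move=> /(_ isT)/(pole_neq0 gen); move/eqP: e; rewrite mulf_eq0 => /orP[|->//].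
  by rewrite expf_eq0 (negPf (pole_neq0 gen (pole_X E f v))) andbF.
rewrite (nil _ _ e0) (nil _ _ e1) (nil _ _ e2) !hom_part0.
by exists q; rewrite !addr0.
Qed.

End HomogeneousVanishing.

(** * Isomorphisms are regular on the affine part *)

Definition image_at (K L : fieldType) (f : {rmorphism K -> L})
    (phi : 3.-tuple {mpoly K[3]}) (v : 'I_3 -> L) : 'I_3 -> L :=
  fun i => evalx f (tnth phi i) v.

Lemma ord3P (P : 'I_3 -> Prop) : P iX -> P iY -> P iZ -> forall i, P i.
Proof.
move=> PX PY PZ [[|[|[|//]]] i3]; [set j := iX|set j := iY|set j := iZ];
  by rewrite (_ : Ordinal i3 = j) //; apply: val_inj.
Qed.

Lemma proportional (L : fieldType) (a b : 'I_3 -> L) :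
    nonzero a -> nonzero b -> (forall i j, a i * b j = a j * b i) ->
  exists2 t, t != 0 & forall i, a i = t * b i.
Proof.
move=> [i ai] [j bj] ab; exists (a j / b j) => [|k]; last first.
  by rewrite mulrAC -ab mulfK.
rewrite mulf_neq0 ?invr_eq0 //; apply: contraNneq ai => aj.
by move/eqP: (ab i j); rewrite aj mul0r mulf_eq0 (negPf bj) orbF.
Qed.

Lemma weq_homog (K : fieldType) (E : weierstrass K) : weq E \is 3.-homog.
Proof.
have hX i : ('X_i : {mpoly K[3]}) \is 1.-homog by rewrite dhomogX /= mdeg1.
have hC c : (c%:MP : {mpoly K[3]}) \is 0.-homog.
  by rewrite -[c%:MP]mulr1 mul_mpolyC; apply/dhomogZ/dhomog1.
have hM d e (p q : {mpoly K[3]}) n : p \is d.-homog -> q \is e.-homog -> n = (d + e)%N ->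
    p * q \is n.-homog.
  by move=> ph qh ->; apply: dhomogM.
have hXn i n : ('X_i ^+ n : {mpoly K[3]}) \is n.-homog.
  by have := dhomogMn n (hX i); rewrite mul1n.
rewrite /weq; apply: rpredB; rewrite ?rpredD //.
- exact: hM (hXn _ _) (hX _) _.
- exact: hM (hM _ _ _ _ _ (hM _ _ _ _ _ (hC _) (hX _) erefl) (hX _) erefl) (hX _) _.
- exact: hM (hM _ _ _ _ _ (hC _) (hX _) erefl) (hXn _ _) _.
- exact: hM (hM _ _ _ _ _ (hC _) (hXn _ _) erefl) (hX _) _.
- exact: hM (hM _ _ _ _ _ (hC _) (hX _) erefl) (hXn _ _) _.
- exact: hM (hC _) (hXn _ _) _.
Qed.

(* The [p] for which [p a / c] and [p b / c] lie in the image of [h] form an ideal. *)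
Lemma denominator_ideal (R : comNzRingType) (F : fieldType) (h : {rmorphism R -> F})
    (a b c : F) :
    let I p := exists G0 G1, h p * a = h G0 * c /\ h p * b = h G1 * c in
  I 1 \/ exists (L : fieldType) (g : {rmorphism R -> L}), forall p, I p -> g p = 0.
Proof.
move=> I; have [|I1] := pselect (I 1); [by left|right].
apply: (proper_ideal_residue (I := I)) I1.
- by exists 0, 0; rewrite rmorph0 !mul0r.
- move=> p q [P0 [P1 [e0 e1]]] [Q0 [Q1 [e0' e1']]]; exists (P0 + Q0), (P1 + Q1).
  by rewrite !rmorphD !mulrDl e0 e1 e0' e1'.
- move=> p q [Q0 [Q1 [e0 e1]]]; exists (p * Q0), (p * Q1).
  by rewrite !rmorphM -!mulrA e0 e1.
Qed.

Section Regularity.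
Variables (K : fieldType) (E E' : weierstrass K).
Variables (phi chi : 3.-tuple {mpoly K[3]}).
Hypothesis phiM : morphism E E' phi.
Hypothesis chiM : morphism E' E chi.
Hypothesis chi_phi : is_identity E (rcomp chi phi).
Hypothesis phi0 : rmap_at (idfun : {rmorphism K -> K}) E phi (@zero_pt K) (@zero_pt K).

Variables (F : fieldType) (f : {rmorphism K -> F}) (xi : 'I_3 -> F).
Hypothesis gen : generic_point E f xi.

Lemma generic_nonzero psi : form_triple E psi -> nonzero (image_at f psi xi).
Proof.
move=> [[d hom] [i ni]]; exists i; apply/eqP => e; apply: ni.
exact: dhomog_vanishes gen (hom i) e.
Qed.

Lemma generic_proportional psi psi' :
    form_triple E psi -> form_triple E psi' -> same_rmap E psi psi' ->
  exists2 t, t != 0 & forall i, image_at f psi xi i = t * image_at f psi' xi i.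
Proof.
move=> h h' same; apply: proportional; try exact: generic_nonzero.
move=> i j; have := vanishes_eval (same i j) gen.1.2.
by rewrite evalxB !evalxM => /eqP; rewrite subr_eq0 => /eqP.
Qed.

Lemma generic_image_curve psi : form_triple E psi -> same_rmap E phi psi ->
  evalx f (weq E') (image_at f psi xi) = 0.
Proof.
move=> h same; have [phih phiE _] := phiM.
have [t t0 e] := generic_proportional phih h same.
have := vanishes_eval phiE gen.1.2.
rewrite evalx_comp (eq_evalx _ (w := fun i => t * image_at f psi xi i)) //.
rewrite (evalx_scale _ _ _ (weq_homog E')) => /eqP.
by rewrite mulf_eq0 expf_eq0 (negPf t0) andbF => /eqP.
Qed.

(** The pulled back equation of E' is a form vanishing at the generic point, hence a multiple of
    [weq E]. *)
Lemma image_curve psi (L : fieldType) (g : {rmorphism K -> L}) v :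
    form_triple E psi -> same_rmap E phi psi -> evalx g (weq E) v = 0 ->
  evalx g (weq E') (image_at g psi v) = 0.
Proof.
move=> h same Ev; have [[d hom] _] := h; rewrite -evalx_comp.
apply: vanishes_eval Ev; apply: dhomog_vanishes gen (dhomog_comp (weq_homog E') hom) _.
by rewrite evalx_comp; apply: generic_image_curve.
Qed.

Lemma generic_inverse rho psi i j :
    form_triple E psi -> same_rmap E phi psi -> same_rmap E' chi rho ->
  xi j * evalx f (tnth rho i) (image_at f psi xi)
  = xi i * evalx f (tnth rho j) (image_at f psi xi).
Proof.
move=> h same same'; have [phih _ _] := phiM; have [[[d chi_hom] _] _ _] := chiM.
have [t t0 e] := generic_proportional phih h same.
have [idh id_same] := chi_phi.
have [s s0 e'] : exists2 s, s != 0 & forall i, image_at f (rcomp chi phi) xi i = s * xi i.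
  apply: proportional => [||k l]; first exact: generic_nonzero.
    by exists iZ; rewrite gen.1.1 oner_neq0.
  have := vanishes_eval (id_same k l) gen.1.2.
  rewrite evalxB !evalxM !tnth_mktuple !evalxX => /eqP.
  by rewrite /image_at !tnth_mktuple subr_eq0 => /eqP.
have chiE k : t ^+ d * evalx f (tnth chi k) (image_at f psi xi) = s * xi k.
  rewrite -e' /image_at tnth_mktuple evalx_comp -(evalx_scale _ _ _ (chi_hom k)).
  by apply: eq_evalx => l; rewrite -e.
have := vanishes_eval (same' i j) (generic_image_curve h same).
rewrite evalxB !evalxM => /eqP; rewrite subr_eq0 => /eqP e2.
apply: (mulfI s0); rewrite [LHS]mulrA [RHS]mulrA -!chiE -[LHS]mulrA -[RHS]mulrA.
by move: e2; move: (t ^+ d) (evalx _ _ _) (evalx _ _ _) (evalx _ _ _) => a b c b' e2; congr (a * _).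
Qed.

(** The composite of two representatives may vanish at v, so only the cross products with v are
    compared. They are forms, hence it suffices to compare them at the generic point. *)
Lemma inverse_at rho psi (L : fieldType) (g : {rmorphism K -> L}) v i j :
    form_triple E psi -> same_rmap E phi psi ->
    form_triple E' rho -> same_rmap E' chi rho -> evalx g (weq E) v = 0 ->
  v j * evalx g (tnth rho i) (image_at g psi v)
  = v i * evalx g (tnth rho j) (image_at g psi v).
Proof.
move=> h same h' same' Ev; have [[d hom] _] := h; have [[e hom'] _] := h'.
pose p := 'X_j * (tnth rho i \mPo psi) - 'X_i * (tnth rho j \mPo psi).
have hX k : ('X_k : {mpoly K[3]}) \is 1.-homog by rewrite dhomogX /= mdeg1.
have ph : p \is (1 + d * e).-homog.
  by rewrite rpredB // dhomogM // dhomog_comp.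
have pv (M : fieldType) (k : {rmorphism K -> M}) w : evalx k p w
  = w j * evalx k (tnth rho i) (image_at k psi w) - w i * evalx k (tnth rho j) (image_at k psi w).
  by rewrite evalxB !evalxM !evalxX !evalx_comp.
have /vanishes_eval/(_ Ev) : vanishes E p.
  apply: dhomog_vanishes gen ph _; rewrite pv.
  by rewrite (generic_inverse i j h same same') subrr.
by rewrite pv => /eqP; rewrite subr_eq0 => /eqP.
Qed.

Lemma zero_on_curve (E1 : weierstrass K) :
  evalx (idfun : {rmorphism K -> K}) (weq E1) (@zero_pt K) = 0.
Proof. by rewrite evalx_weq /weq_at /zero_pt /=; ring. Qed.

(** Take rho regular at the zero of E' and psi the representative of phi sending zero to zero: rho
    after psi is proportional to the identity, so rho sends zero to a multiple of zero, and
    regularity makes it nonzero. *)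
Lemma inverse_zero : exists rho, [/\ form_triple E' rho, same_rmap E' chi rho &
  exists2 b, b != 0 & forall i,
    evalx (idfun : {rmorphism K -> K}) (tnth rho i) (@zero_pt K) = b * @zero_pt K i].
Proof.
have [_ _ reg] := chiM.
have [|w [w0 [rho [h same [c c0 e]]]]] := reg K idfun (@zero_pt K).
  by split; [exists iY; rewrite /zero_pt eqxx oner_neq0|exact: zero_on_curve].
exists rho; split=> //.
have [_ [psi [h' same' [a a0 e']]]] := phi0.
have [[d hom] _] := h.
have cross i : evalx idfun (tnth rho i) (@zero_pt K)
    = @zero_pt K i * evalx idfun (tnth rho iY) (@zero_pt K).
  have := inverse_at i iY h' same' h same (zero_on_curve E).
  have scale k : evalx idfun (tnth rho k) (image_at idfun psi (@zero_pt K))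
      = a ^+ d * evalx idfun (tnth rho k) (@zero_pt K).
    by rewrite -(evalx_scale _ _ _ (hom k)); apply: eq_evalx.
  rewrite !scale [@zero_pt K iY]/zero_pt eqxx mul1r mulrCA.
  by apply: mulfI; rewrite expf_neq0.
exists (evalx idfun (tnth rho iY) (@zero_pt K)); last by move=> i; rewrite mulrC.
have [i wi] := w0; have: c * w i != 0 by rewrite mulf_neq0.
by rewrite -e cross; apply: contraNneq => ->; rewrite mulr0.
Qed.

Lemma inverse_rmap_zero :
  rmap_at (idfun : {rmorphism K -> K}) E' chi (@zero_pt K) (@zero_pt K).
Proof.
have [rho [h same e]] := inverse_zero; split; last by exists rho.
by exists iY; rewrite /zero_pt eqxx oner_neq0.
Qed.

(** The only point of E' with Z = 0 is its zero. A representative of chi sends it to the zero of E,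
    but the composite is proportional to v, whose Z is 1. *)
Lemma affine_image_neq0 psi (L : fieldType) (g : {rmorphism K -> L}) v :
    form_triple E psi -> same_rmap E phi psi -> affine_point E g v ->
  nonzero (image_at g psi v) -> image_at g psi v iZ != 0.
Proof.
move=> h same [z1 Ev] nz; apply/negP => /eqP w2.
set w := image_at g psi v in nz w2.
have w0 : w iX = 0.
  have := image_curve h same Ev; rewrite -/w evalx_weq /weq_at w2.
  move: (w iX) (w iY) => x y e.
  have /eqP : x ^+ 3 = 0 by rewrite -oppr0 -e; ring.
  by rewrite expf_eq0 => /eqP.
have [rho [h' same' [b b0 e]]] := inverse_zero.
have [[d hom] _] := h'.
have scale i : evalx g (tnth rho i) w = w iY ^+ d * g (b * @zero_pt K i).
  rewrite -e rmorph_evalx -[evalx (g \o idfun) _ _]/(evalx g _ _).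
  rewrite -(evalx_scale _ _ _ (hom i)); apply: eq_evalx.
  by apply: ord3P; rewrite /zero_pt ?eqxx /= ?rmorph1 ?rmorph0 ?mulr1 ?mulr0.
have := inverse_at iY iZ h same h' same' Ev; rewrite -/w !scale z1 mul1r.
rewrite /zero_pt eqxx /= !mulr0 rmorph0 !mulr0 mulr1 => /eqP.
rewrite mulf_eq0 fmorph_eq0 (negPf b0) orbF expf_eq0 => /andP [_ /eqP w1].
by have [] := nz; apply: ord3P; rewrite ?w0 ?w1 ?w2 eqxx.
Qed.

Lemma regular_coordinates : image_at f phi xi iZ != 0 /\
  exists G0 G1, image_at f phi xi iX = evalx f G0 xi * image_at f phi xi iZ
             /\ image_at f phi xi iY = evalx f G1 xi * image_at f phi xi iZ.
Proof.
have [phih _ reg] := phiM.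
have phi_same : same_rmap E phi phi by move=> i j; exists 0; rewrite mul0r mulrC subrr.
split; first exact: affine_image_neq0 phih phi_same gen.1 (generic_nonzero phih).
case: (denominator_ideal (eval_at f xi) (image_at f phi xi iX) (image_at f phi xi iY)
  (image_at f phi xi iZ)).
  by case=> G0 [G1]; rewrite rmorph1 !mul1r; exists G0, G1.
(* A polynomial vanishing at xi is a denominator with numerators 0, so g kills it and the images of
   the variables form an affine point v of E. *)
case=> L [g gI]; have Inull p : evalx f p xi = 0 -> g p = 0.
  move=> p0; apply: gI; exists 0, 0.
  by rewrite rmorph0 /= [eval_at f xi p]p0 !mul0r.
pose k : {rmorphism K -> L} := g \o @mpolyC 3 K.
pose v i := g 'X_i.
have gE p : g p = evalx k p v by apply: morph_evalx.
have vz : v iZ = 1.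
  apply/eqP; rewrite -subr_eq0 /v -(rmorph1 g) -rmorphB; apply/eqP/Inull.
  by rewrite evalxB evalxX gen.1.1 [X in _ - X](rmorph1 (eval_at f xi)) subrr.
have Ev : evalx k (weq E) v = 0 by rewrite -gE; apply: Inull; exact: gen.1.2.
have vnz : nonzero v by exists iZ; rewrite vz oner_neq0.
have [w [[i wi] [psi [h same [c c0 e]]]]] := reg L k v (conj vnz Ev).
have nz : nonzero (image_at k psi v) by exists i; rewrite /image_at e mulf_neq0.
(* The third component of psi is itself a denominator, so g kills it; yet it cannot vanish at v,
   where psi is regular. *)
have := affine_image_neq0 h same (conj vz Ev) nz; rewrite /image_at -gE gI ?eqxx //.
exists (tnth psi iX), (tnth psi iY).
have cross i' : evalx f (tnth psi iZ) xi * image_at f phi xi i'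
    = evalx f (tnth psi i') xi * image_at f phi xi iZ.
  have := vanishes_eval (same i' iZ) gen.1.2; rewrite evalxB !evalxM => /eqP.
  by rewrite subr_eq0 [LHS]mulrC [RHS]mulrC => /eqP.
by split; apply: cross.
Qed.

End Regularity.

(** The normal form P + Q y of p is zero at the generic point, so P = Q = 0. This covers polynomials
    of mixed degree, at affine points. *)
Lemma generic_specialize (K F L : fieldType) (E : weierstrass K)
    (f : {rmorphism K -> F}) xi (g : {rmorphism K -> L}) v p :
    generic_point E f xi -> affine_point E g v ->
  evalx f p xi = 0 -> evalx g p v = 0.
Proof.
move=> gen Ev; have [P [Q e]] := affine_form E p.
rewrite (e _ _ _ gen.1) (e _ _ _ Ev) => /gen.2 [-> ->].
by rewrite /reduced map_poly0 horner0 mul0r addr0.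
Qed.

(** * The isomorphism of affine coordinate rings *)

Section Coordinates.
Variables (K : fieldType) (E E' : weierstrass K).
Variables (phi chi : 3.-tuple {mpoly K[3]}).
Hypothesis phiM : morphism E E' phi.
Hypothesis chiM : morphism E' E chi.
Hypothesis chi_phi : is_identity E (rcomp chi phi).
Hypothesis phi_chi : is_identity E' (rcomp phi chi).
Hypothesis phi0 : rmap_at (idfun : {rmorphism K -> K}) E phi (@zero_pt K) (@zero_pt K).
Variables (F : fieldType) (f : {rmorphism K -> F}) (xi : 'I_3 -> F).
Hypothesis gen : generic_point E f xi.

(* An isomorphism identifies the two affine coordinate rings. *)
Lemma coordinates_generate : exists eta, [/\ affine_point E' f eta,
  exists P Q, eta iX = reduced f xi P Q, exists P Q, eta iY = reduced f xi P Q,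
  exists P Q, xi iX = reduced f eta P Q & exists P Q, xi iY = reduced f eta P Q].
Proof.
have [c0 [G0 [G1 [eX eY]]]] := regular_coordinates phiM chiM chi_phi phi0 gen.
set c := image_at f phi xi iZ in c0 eX eY.
pose eta i := c^-1 * image_at f phi xi i.
have imgE i : image_at f phi xi i = c * eta i by rewrite /eta mulVKf.
have same (psi : 3.-tuple {mpoly K[3]}) (E1 : weierstrass K) : same_rmap E1 psi psi.
  by move=> i j; exists 0; rewrite mul0r mulrC subrr.
have [phih _ _] := phiM; have [[[d chi_hom] _] _ _] := chiM.
have Eeta : affine_point E' f eta.
  split; first by rewrite /eta mulVf.
  rewrite (evalx_scale _ _ _ (weq_homog E')).
  by rewrite (generic_image_curve phiM gen phih (same phi E)) mulr0.
have reg_eta p : exists P Q, evalx f p xi = reduced f xi P Q.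
  by have [P [Q e]] := affine_form E p; exists P, Q; apply: e gen.1.
(* It is not known that eta is generic on E', so the regularity of chi is established at another
   generic point of E' and specialized to eta. *)
have [F' [f' [xi' gen']]] := generic_point_exists E'.
have chi0 := inverse_rmap_zero phiM chiM chi_phi phi0 gen.
have [_ [H0 [H1 [hX hY]]]] := regular_coordinates chiM phiM phi_chi chi0 gen'.
have transfer H i : image_at f' chi xi' i = evalx f' H xi' * image_at f' chi xi' iZ ->
    image_at f chi eta i = evalx f H eta * image_at f chi eta iZ.
  move/eqP; rewrite -subr_eq0 -evalxM -evalxB => /eqP /(generic_specialize gen' Eeta).
  by move/eqP; rewrite evalxB evalxM subr_eq0 => /eqP.
have {hX} hX := transfer _ _ hX; have {hY} hY := transfer _ _ hY.
have scale i : image_at f chi (image_at f phi xi) i = c ^+ d * image_at f chi eta i.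
  rewrite /image_at -(evalx_scale _ _ _ (chi_hom i)).
  by apply: eq_evalx => j; rewrite -imgE.
(* The triple chi(eta) is nonzero because chi(phi(xi)) is, and its X and Y components are multiples
   of its Z component. *)
have z0 : image_at f chi eta iZ != 0.
  have [i] := generic_nonzero gen chi_phi.1.
  rewrite {1}/image_at tnth_mktuple evalx_comp.
  rewrite -[X in X != 0 -> _]/(image_at f chi (image_at f phi xi) i) scale.
  rewrite mulf_eq0 => /norP [_ ni]; apply: contraNneq ni => z0.
  have: forall i, image_at f chi eta i = 0.
    by apply: ord3P; rewrite ?hX ?hY z0 // mulr0.
  by move->.
have cross i : image_at f chi eta i = xi i * image_at f chi eta iZ.
  have := generic_inverse phiM chiM chi_phi gen i iZ phih (same phi E) (same chi E').
  rewrite -![evalx _ _ _]/(image_at f chi (image_at f phi xi) _) !scale gen.1.1 mul1r.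
  by rewrite mulrCA => /mulfI; apply; rewrite expf_neq0.
have inv_eta H i : image_at f chi eta i = evalx f H eta * image_at f chi eta iZ ->
    exists P Q, xi i = reduced f eta P Q.
  rewrite cross => /(mulIf z0) ->.
  by have [P [Q e]] := affine_form E' H; exists P, Q; apply: e Eeta.
exists eta; split=> //.
- by rewrite /eta eX mulrC mulfK //; apply: reg_eta.
- by rewrite /eta eY mulrC mulfK //; apply: reg_eta.
- exact: inv_eta hX.
- exact: inv_eta hY.
Qed.

End Coordinates.

(** * Pole orders of the pulled back coordinates *)

Section PoleOrders.
Variables (K : fieldType) (E E' : weierstrass K).
Variables (F : fieldType) (f : {rmorphism K -> F}) (xi eta : 'I_3 -> F).
Hypothesis gen : generic_point E f xi.
Hypothesis Eeta : affine_point E' f eta.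
Hypothesis etaX : exists P Q, eta iX = reduced f xi P Q.
Hypothesis etaY : exists P Q, eta iY = reduced f xi P Q.
Hypothesis xiX : exists P Q, xi iX = reduced f eta P Q.
Hypothesis xiY : exists P Q, xi iY = reduced f eta P Q.

Local Notation pole := (pole E f xi).

Lemma reduced_pole_eq a : (exists P Q, a = reduced f xi P Q) -> a = 0 \/ exists n, pole a n.
Proof. by case=> P [Q ->]; apply: reduced_pole. Qed.

Lemma pole0_const a : pole a 0 -> exists c, a = f c.
Proof.
move=> /poleW [P [Q [-> w]]]; exists P`_0; move: w; rewrite weightE => w.
have /size1_polyC eP : (size P <= 1)%N by slia.
have /eqP : size Q = 0%N by slia.
rewrite size_poly_eq0 => /eqP ->.
by rewrite {1}eP /reduced map_polyC map_poly0 !hornerE.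
Qed.

Lemma eta_eq : eta iY * (eta iY + (map_poly f (ylin E')).[eta iX])
  = (map_poly f (ycub E')).[eta iX].
Proof. by rewrite mulrDr -expr2 (affine_point_sqr Eeta) [X in _ + X]mulrC subrK. Qed.

(** With x' constant, y' satisfies a monic quadratic with constant coefficients and so has no pole.
    Then x, a polynomial in x' and y', would be constant, against its pole order 2. *)
Lemma etaX_nonconst c : eta iX <> f c.
Proof.
move=> eX.
have cst P : (map_poly f P).[eta iX] = f P.[c] by rewrite eX horner_map.
have constY : exists d, eta iY = f d.
  have [->|[[|n] pn]] := reduced_pole_eq etaY; first by exists 0; rewrite rmorph0.
    exact: pole0_const.
  have := eta_eq; rewrite !cst; set l := _.[c]; set r := _.[c] => e.
  have pl : pole (eta iY + f l) n.+1.
    have [->|l0] := eqVneq l 0; first by rewrite rmorph0 addr0.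
    by rewrite addrC; apply: poleD_lt (pole_const E f xi l0) pn.
  have := poleM gen pn pl; rewrite e.
  have [->|r0] := eqVneq r 0; first by rewrite rmorph0 => /(pole_neq0 gen); rewrite eqxx.
  by move/(pole_uniq gen (pole_const E f xi r0)).
have [d eY] := constY; have [P [Q]] := xiX; rewrite /reduced !cst eY -rmorphM -rmorphD => e.
have := pole_X E f xi; rewrite e; set k := _ + _.
have [->|k0] := eqVneq k 0; first by rewrite rmorph0 => /(pole_neq0 gen); rewrite eqxx.
by move/(pole_uniq gen (pole_const E f xi k0)).
Qed.

(** Let x' and y' have pole orders m and n. In y' (y' + [ylin](x')) = [ycub](x') the right side has
    order 3m; if n did not exceed the order of [ylin](x'), the left side would have order at most
    2m. Hence 2n = 3m, and k = n - m. *)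
Lemma pole_eta_ratio : exists2 k, (0 < k)%N & pole (eta iX) (2 * k) /\ pole (eta iY) (3 * k).
Proof.
have [eX|[m pm]] := reduced_pole_eq etaX.
  by case: (@etaX_nonconst 0); rewrite rmorph0.
have m0 : (0 < m)%N.
  by case: m pm => // /pole0_const [c /etaX_nonconst].
have pr : pole (map_poly f (ycub E')).[eta iX] (m * 3).
  have ycub0 : ycub E' != 0 by rewrite -size_poly_eq0 size_ycub.
  by have := pole_horner gen pm m0 ycub0; rewrite size_ycub.
have [eY|[n pn]] := reduced_pole_eq etaY.
  by move: (pole_neq0 gen pr); rewrite -eta_eq eY mul0r eqxx.
have le_sum n' : pole (eta iY + (map_poly f (ylin E')).[eta iX]) n' -> (n + n' = m * 3)%N.
  by move=> p'; have := poleM gen pn p'; rewrite eta_eq => /(pole_uniq gen); apply.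
have pl : (map_poly f (ylin E')).[eta iX] = 0 \/
    exists2 l, (l <= m)%N & pole (map_poly f (ylin E')).[eta iX] l.
  have [->|l0] := eqVneq (ylin E') 0; first by left; rewrite map_poly0 horner0.
  right; exists (m * (size (ylin E')).-1)%N; last exact: pole_horner.
  by have := size_ylin E'; case: (size _) => [|[|[|]]] // _; rewrite ?muln0 ?muln1.
suff e : (n + n = m * 3)%N.
  exists (n - m)%N; first by lia.
  have -> : (2 * (n - m) = m)%N by lia.
  by have -> : (3 * (n - m) = n)%N by lia.
case: pl => [l0|[l lm pl]]; first by apply: le_sum; rewrite l0 addr0.
have [lt|ge] := ltnP l n; first by apply: le_sum; rewrite addrC; apply: poleD_lt pl pn.
have [s0|[k km /le_sum]] := poleD_le gen pn pl; last by lia.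
by move: (pole_neq0 gen pr); rewrite -eta_eq s0 mulr0 eqxx.
Qed.

Lemma pole_eta : pole (eta iX) 2 /\ pole (eta iY) 3.
Proof.
have [k k0 [pX pY]] := pole_eta_ratio.
(* The even and the odd multiples of k: the possible orders of P(x') and of Q(x') y', which
   therefore cannot cancel. *)
pose S0 n := (exists j, n = k * (2 * j))%N.
pose S1 n := (exists j, n = k * (2 * j + 3))%N.
have dvd a n : (exists P Q, a = reduced f eta P Q) -> pole a n -> (k %| n)%N.
  move=> [P [Q ->]] pa.
  have k2 : (0 < 2 * k)%N by lia.
  have p0 : pole_in E f xi S0 (map_poly f P).[eta iX].
    have [->|P0] := eqVneq P 0; first by left; rewrite map_poly0 horner0.
    right; exists (2 * k * (size P).-1)%N; last exact: pole_horner.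
    by exists (size P).-1; rewrite mulnCA mulnA.
  have p1 : pole_in E f xi S1 ((map_poly f Q).[eta iX] * eta iY).
    have [->|Q0] := eqVneq Q 0; first by left; rewrite map_poly0 horner0 mul0r.
    right; exists (2 * k * (size Q).-1 + 3 * k)%N; last exact/(poleM gen)/pY/pole_horner.
    by exists (size Q).-1; rewrite mulnDr mulnCA mulnA [(3 * k)%N]mulnC.
  have [|pin _] := pole_inD gen p0 p1.
    by move=> _ _ [i ->] [j ->] /eqP; rewrite eqn_pmul2l //; lia.
  case: pin => [z0|[n' Sn' pn']].
    by move: (pole_neq0 gen pa); rewrite /reduced z0 eqxx.
  rewrite (pole_uniq gen pa pn').
  by case: Sn' => [] [j ->]; apply: dvdn_mulr.
have d2 := dvd _ _ xiX (pole_X E f xi); have d3 := dvd _ _ xiY (pole_Y E f xi).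
have k1 : k = 1%N.
  by apply/eqP; rewrite -dvdn1 -(dvdn_addr 1 d2).
by move: pX pY; rewrite k1.
Qed.

End PoleOrders.

(** * The normal form of a curve with a point of order 4 *)

Section Model.
Variable K : fieldType.
Implicit Types (E : weierstrass K) (v rho sigma tau g : K).

(* The curve with equation
   [(y - sigma x - tau)^2 + v (x - rho) (y - sigma x - tau) = (x - rho)^3 + v^6 g^4],
   that is, [E4 g] in the coordinates [x = v^2 x' + rho], [y = v^3 y' + sigma x + tau]. *)
Definition model v rho sigma tau g : weierstrass K := Weierstrass
  (v - sigma *+ 2)
  (v * sigma - sigma ^+ 2 - rho *+ 3)
  (- (v * rho) - tau *+ 2)
  (rho ^+ 2 *+ 3 - sigma * tau *+ 2 + v * tau - v * rho * sigma)
  (v ^+ 6 * g ^+ 4 - rho ^+ 3 - tau ^+ 2 - v * rho * tau).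

(** Equality modulo 2 with an explicit witness t, so that what remains is an identity suited to
    [ring]. *)
Lemma char2_eq (a b t : K) : 2%N \in [pchar K] -> a - b = t *+ 2 -> a = b.
Proof.
move=> charK; rewrite -mulr_natr (pcharf0 charK) mulr0 => /eqP.
by rewrite subr_eq0 => /eqP.
Qed.

Lemma weierstrass_eq E E' : a1 E = a1 E' -> a2 E = a2 E' -> a3 E = a3 E' ->
  a4 E = a4 E' -> a6 E = a6 E' -> E = E'.
Proof. by case: E E' => [? ? ? ? ?] [? ? ? ? ?] /= -> -> -> -> ->. Qed.

Lemma order4_model E P : 2%N \in [pchar K] -> on_curve E P -> has_order E P 4 ->
  exists v rho sigma tau g, [/\ v != 0, g != 0 & E = model v rho sigma tau g].
Proof.
move=> charK; case: P => [_ [_ _ /(_ 1%N isT)]|x0 y0 /= EP]; first by [].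
case=> _; rewrite /pmul /= => four less.
have := less 2%N isT; have := less 3%N isT; rewrite /pmul {less} /=.
move: four; rewrite !eqxx /=.
have [//|d0] := eqVneq (y0 + y0 + a1 E * x0 + a3 E) 0.
(* [lam] is the slope of the tangent at P, and ([x2], [y2]) is T = 2P. *)
set lam := (_ / _); set x2 := lam ^+ 2 + _ - _ - _ - _; set y2 := - _ - _ - _ => /=.
have lamE : lam * (y0 *+ 2 + a1 E * x0 + a3 E) = x0 ^+ 2 *+ 3 + a2 E * x0 *+ 2 + a4 E - a1 E * y0.
  by rewrite /lam mulfVK // mulr2n.
(* Equal abscissas would make 3P zero. *)
have [x02|x02] /= := eqVneq x0 x2.
  have -> : y0 + y2 + a1 E * x2 + a3 E == 0.
    by rewrite /y2 -x02; apply/eqP; ring.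
  by [].
set l := (_ / _); set x3 := l ^+ 2 + _ - _ - _ - _.
case: eqVneq => [x03|//] /= _ _ _.
have x20 : x2 - x0 != 0 by rewrite subr_eq0 eq_sym.
have lE : l * (x2 - x0) = y2 - y0 by rewrite /l mulfVK.
(* 4P = 0 gives 3P the abscissa of P, so the slope [l] of the line through P and T is [lam] or
   -[lam] - a1. The latter would give P order 2; so T lies on the tangent at P, hence T = -T. *)
have : (l - lam) * (l + lam + a1 E) == 0.
  have -> : (l - lam) * (l + lam + a1 E) = x3 - x0 by rewrite /x3 /x2; ring.
  by rewrite -x03 subrr.
rewrite mulf_eq0 => /orP [|] l_eq; last first.
  case/eqP: d0; have : (l + lam + a1 E) * (x2 - x0) = 0 by rewrite (eqP l_eq) mul0r.
  rewrite mulrDl mulrDl lE => e; rewrite -oppr0 -e /y2; ring.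
have T2 : a1 E * x2 + a3 E = 0.
  apply: (@char2_eq _ _ (- y2)) => //; move: lE; rewrite (subr0_eq (eqP l_eq)) => e.
  have -> : a1 E * x2 + a3 E = - y2 - (y0 + lam * (x2 - x0)) by rewrite /y2; ring.
  by rewrite e; ring.
have v0 : a1 E != 0.
  apply: contra_neqN d0 => /eqP v0; move: T2; rewrite v0 mul0r add0r => ->.
  by rewrite mul0r !addr0 -mulr2n -mulr_natr (pcharf0 charK) mulr0.
(* These values make [lam] horizontal, give T abscissa 0 and put P at (g, g^2); [tau] is solved from
   the ordinate of P. *)
pose v := a1 E; pose g := (x0 - x2) / v ^+ 2.
have gE : v ^+ 2 * g = x0 - x2 by rewrite /g mulrC mulfVK // expf_neq0.
pose tau := y0 - v ^+ 3 * g ^+ 2 - lam * x0.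
have g4 : v * tau = v * y0 - (x0 - x2) ^+ 2 - v * lam * x0 by rewrite -gE /tau; ring.
exists v, x2, lam, tau, g; split=> //.
  by rewrite mulf_neq0 ?invr_eq0 ?expf_neq0 // -oppr_eq0 opprB.
have e1 : a1 E = v - lam *+ 2 by apply: (@char2_eq _ _ lam charK); rewrite /v; ring.
have e3 : a3 E = - (v * x2) - tau *+ 2.
  apply: (@char2_eq _ _ tau charK); rewrite (_ : a3 E = - (a1 E * x2)); last first.
    by apply/eqP; rewrite -addr_eq0 addrC T2.
  by rewrite /v; ring.
have e2 : a2 E = v * lam - lam ^+ 2 - x2 *+ 3.
  apply: (@char2_eq _ _ (lam ^+ 2 - x0 + x2) charK).
  have -> : a2 E = lam ^+ 2 + v * lam - x0 - x0 - x2 by rewrite /x2 /v; ring.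
  ring.
have e4 : a4 E = x2 ^+ 2 *+ 3 - lam * tau *+ 2 + v * tau - v * x2 * lam.
  apply: (@char2_eq _ _ (lam * y0 + lam * v * x0 - x0 ^+ 2 - x0 * x2 - x2 ^+ 2
    + lam * tau - a2 E * x0) charK).
  rewrite g4; have -> : a4 E = lam * (y0 *+ 2 + v * x0 - v * x2)
      - x0 ^+ 2 *+ 3 - a2 E * x0 *+ 2 + v * y0.
    have -> : - (v * x2) = a3 E by apply/eqP; rewrite eqr_oppLR -addr_eq0 T2.
    by rewrite lamE /v; ring.
  by ring.
apply: weierstrass_eq => //=.
have -> : a6 E = y0 ^+ 2 + a1 E * x0 * y0 + a3 E * y0 - (x0 ^+ 3 + a2 E * x0 ^+ 2 + a4 E * x0).
  by rewrite EP; ring.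
rewrite e1 e2 e3 e4.
have -> : x0 = v ^+ 2 * g + x2 by rewrite gE subrK.
have -> : y0 = tau + v ^+ 3 * g ^+ 2 + lam * (v ^+ 2 * g + x2) by rewrite gE subrK /tau; ring.
by ring.
Qed.

Lemma model_order4 v rho sigma tau g : 2%N \in [pchar K] -> v != 0 -> g != 0 ->
  exists P, on_curve (model v rho sigma tau g) P /\ has_order (model v rho sigma tau g) P 4.
Proof.
move=> charK v0 g0; set E := model _ _ _ _ _.
(* The images of (g, g^2), (0, g^2) and (g, g^2 + g) on [E4 g], which are P, 2P and 3P = -P. *)
pose x0 := v ^+ 2 * g + rho; pose y0 := v ^+ 3 * g ^+ 2 + sigma * x0 + tau.
pose T : point K := Aff rho (v ^+ 3 * g ^+ 2 + sigma * rho + tau).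
pose N : point K := Aff x0 (v ^+ 3 * (g ^+ 2 + g) + sigma * x0 + tau).
have x0rho : x0 - rho = v ^+ 2 * g by rewrite /x0 addrK.
have nz : v ^+ 2 * g != 0 by rewrite mulf_neq0 ?expf_neq0.
have dbl : padd E (Aff x0 y0) (Aff x0 y0) = T.
  have dE : y0 *+ 2 + a1 E * x0 + a3 E = v ^+ 3 * g.
    by apply: (@char2_eq _ _ (v ^+ 3 * g ^+ 2) charK); rewrite /y0 /x0 /=; ring.
  have d0 : v ^+ 3 * g != 0 by rewrite mulf_neq0 ?expf_neq0.
  rewrite /padd eqxx -mulr2n dE (negPf d0) [true && false]/=.
  have -> : x0 ^+ 2 *+ 3 + a2 E * x0 *+ 2 + a4 E - a1 E * y0 = sigma * (v ^+ 3 * g).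
    apply: (@char2_eq _ _ (v ^+ 4 * g ^+ 2 + sigma * v ^+ 3 * g ^+ 2) charK).
    by rewrite /y0 /x0 /=; ring.
  rewrite mulfK //; have -> : sigma ^+ 2 + a1 E * sigma - a2 E - x0 - x0 = rho.
    by apply: (@char2_eq _ _ (- (v ^+ 2 * g)) charK); rewrite /x0 /=; ring.
  congr Aff; apply: (@char2_eq _ _ (- (v ^+ 3 * g ^+ 2)) charK).
  by rewrite /y0 /=; ring.
have tpl : padd E (Aff x0 y0) T = N.
  have x0T : x0 == rho = false by rewrite -subr_eq0 x0rho (negPf nz).
  have lE : (v ^+ 3 * g ^+ 2 + sigma * rho + tau - y0) / (rho - x0) = sigma.
    rewrite (_ : _ - y0 = sigma * (rho - x0)) ?mulfK //; last by rewrite /y0; ring.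
    by rewrite subr_eq0 eq_sym x0T.
  rewrite /padd /T x0T lE /=.
  have -> : sigma ^+ 2 + (v - sigma *+ 2) * sigma - (v * sigma - sigma ^+ 2 - rho *+ 3)
      - x0 - rho = x0.
    by apply: (@char2_eq _ _ (rho - x0) charK); ring.
  congr Aff; apply: (@char2_eq _ _ (- (v ^+ 3 * (g ^+ 2 + g))) charK).
  by rewrite /y0 /x0; ring.
have qdr : padd E (Aff x0 y0) N = Inf.
  rewrite /padd /N eqxx.
  rewrite (_ : y0 + _ + _ + _ = 0) ?eqxx //.
  apply: (@char2_eq _ _ (v ^+ 3 * (g ^+ 2 + g)) charK).
  by rewrite /y0 /x0 /=; ring.
exists (Aff x0 y0); split; first by rewrite /= /y0 /x0; ring.
have m2 : pmul E 2 (Aff x0 y0) = T by rewrite -dbl.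
have m3 : pmul E 3 (Aff x0 y0) = N by rewrite -tpl -m2.
split=> //; first by rewrite -qdr -m3.
by case=> [|[|[|[|n]]]] // _; rewrite ?m2 ?m3.
Qed.

(* The change of coordinates and its inverse, up to the factor [v^3]. *)
Definition to_E4 v rho sigma tau : 3.-tuple {mpoly K[3]} :=
  [tuple v%:MP * ('X_iX - rho%:MP * 'X_iZ);
         'X_iY - sigma%:MP * 'X_iX - tau%:MP * 'X_iZ;
         v%:MP ^+ 3 * 'X_iZ].

Definition of_E4 v rho sigma tau : 3.-tuple {mpoly K[3]} :=
  [tuple v%:MP ^+ 2 * 'X_iX + rho%:MP * 'X_iZ;
         v%:MP ^+ 3 * 'X_iY + sigma%:MP * (v%:MP ^+ 2 * 'X_iX + rho%:MP * 'X_iZ)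
           + tau%:MP * 'X_iZ;
         'X_iZ].

Lemma linear_form_homog (p : {mpoly K[3]}) (a b c : K) :
  p = a%:MP * 'X_iX + b%:MP * 'X_iY + c%:MP * 'X_iZ -> p \is 1.-homog.
Proof.
have hX i : ('X_i : {mpoly K[3]}) \is 1.-homog by rewrite dhomogX /= mdeg1.
by move=> ->; rewrite !mul_mpolyC; apply/rpredD; [apply/rpredD|]; apply/dhomogZ/hX.
Qed.

Lemma to_E4_homog v rho sigma tau i : tnth (to_E4 v rho sigma tau) i \is 1.-homog.
Proof.
elim/ord3P: i; rewrite /tnth /=.
- by apply: (linear_form_homog (a := v) (b := 0) (c := - (v * rho)));
    rewrite !(mpolyC0, mpolyCN, mpolyCM); ring.
- by apply: (linear_form_homog (a := - sigma) (b := 1) (c := - tau));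
    rewrite !(mpolyC1, mpolyCN); ring.
- by apply: (linear_form_homog (a := 0) (b := 0) (c := v ^+ 3));
    rewrite !(mpolyC0, rmorphXn) /=; ring.
Qed.

Lemma of_E4_homog v rho sigma tau i : tnth (of_E4 v rho sigma tau) i \is 1.-homog.
Proof.
elim/ord3P: i; rewrite /tnth /=.
- by apply: (linear_form_homog (a := v ^+ 2) (b := 0) (c := rho));
    rewrite !(mpolyC0, rmorphXn) /=; ring.
- apply: (linear_form_homog (a := sigma * v ^+ 2) (b := v ^+ 3) (c := sigma * rho + tau)).
  by rewrite !(mpolyCD, mpolyCM, rmorphXn) /=; ring.
- by apply: (linear_form_homog (a := 0) (b := 0) (c := 1)); rewrite !(mpolyC0, mpolyC1); ring.
Qed.

End Model.

(** * Linear isomorphisms *)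

Section LinearMorphisms.
Variable K : fieldType.

Lemma comp_mpolyX1 (lq : 3.-tuple {mpoly K[3]}) i : 'X_i \mPo lq = tnth lq i.
Proof. by rewrite comp_mpolyXU -tnth_nth. Qed.

Lemma weq_comp (E : weierstrass K) (lq : 3.-tuple {mpoly K[3]}) :
  let x := tnth lq iX in let y := tnth lq iY in
  let z := tnth lq iZ in
  weq E \mPo lq = y ^+ 2 * z + (a1 E)%:MP * x * y * z + (a3 E)%:MP * y * z ^+ 2
  - (x ^+ 3 + (a2 E)%:MP * x ^+ 2 * z + (a4 E)%:MP * x * z ^+ 2 + (a6 E)%:MP * z ^+ 3).
Proof.
rewrite /weq !(rmorphB, rmorphD, rmorphM, rmorphXn) /=.
by rewrite ![_%:MP \mPo _]comp_mpolyC !comp_mpolyX1.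
Qed.

(** Since T' after T is multiplication by k, nonzero, T vanishes at no point and is its own regular
    representative everywhere. *)
Lemma linear_isomorphism (E E' : weierstrass K) (T T' : 3.-tuple {mpoly K[3]}) (c k : K) :
    (forall i, tnth T i \is 1.-homog) -> (forall i, tnth T' i \is 1.-homog) ->
    k != 0 -> weq E' \mPo T = c%:MP * weq E ->
    (forall i, tnth T' i \mPo T = k%:MP * 'X_i) ->
  morphism E E' T /\ is_identity E (rcomp T' T).
Proof.
move=> hT hT' k0 eT inv.
have nz (L : fieldType) (f : {rmorphism K -> L}) v : nonzero v -> nonzero (image_at f T v).
  move=> [i vi]; have [//|z] := pselect (nonzero (image_at f T v)).
  have := evalx_comp f (tnth T' i) T v; rewrite inv evalxM evalxC evalxX => e.
  have : f k * v i != 0 by rewrite mulf_neq0 ?fmorph_eq0.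
  rewrite e (eq_evalx _ (w := fun j => 0 * v j)).
    by rewrite (evalx_scale _ _ _ (hT' i)) expr1 mul0r eqxx.
  by move=> j; rewrite mul0r; apply/eqP/contraT => zj; case: z; exists j.
have O0 : nonzero (@zero_pt K) by exists iY; rewrite /zero_pt eqxx oner_neq0.
have fT : form_triple E T.
  split; first by exists 1%N.
  have [i ni] := nz _ idfun _ O0; exists i => /vanishes_eval/(_ (zero_on_curve E)) e.
  by rewrite /image_at e eqxx in ni.
split; first split=> //.
- by exists c%:MP.
- move=> L f v [v0 _]; exists (image_at f T v); split; first exact: nz.
  exists T; split=> //; first by move=> i j; exists 0; rewrite mul0r mulrC subrr.
  by exists 1; [rewrite oner_neq0|move=> i; rewrite mul1r].
have hX i : ('X_i : {mpoly K[3]}) \is 1.-homog by rewrite dhomogX /= mdeg1.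
have invE i : tnth (rcomp T' T) i = k%:MP * 'X_i by rewrite tnth_mktuple.
split; first split.
- by exists 1%N => i; rewrite invE mul_mpolyC; apply/dhomogZ/hX.
- exists iY; rewrite invE => /vanishes_eval/(_ (zero_on_curve E)) /eqP.
  by rewrite evalxM evalxC evalxX /zero_pt eqxx mulr1 (negPf k0).
- by move=> i j; exists 0; rewrite !invE !tnth_mktuple mul0r; ring.
Qed.

Lemma model_isomorphic v rho sigma tau (g : K) : v != 0 ->
  K_isomorphic (model v rho sigma tau g) (E4 g).
Proof.
move=> v0; set E := model _ _ _ _ _.
have v30 : v ^+ 3 != 0 by rewrite expf_neq0.
have tE : weq (E4 g) \mPo to_E4 v rho sigma tau = (v ^+ 3)%:MP * weq E.
  rewrite weq_comp /weq /tnth /=.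
  rewrite !(mpolyCB, mpolyCD, mpolyCN, mpolyCM, mpolyCMn, rmorphXn, mpolyC0, mpolyC1) /=.
  by ring.
have oE : weq E \mPo of_E4 v rho sigma tau = (v ^+ 6)%:MP * weq (E4 g).
  rewrite weq_comp /weq /tnth /=.
  rewrite !(mpolyCB, mpolyCD, mpolyCN, mpolyCM, mpolyCMn, rmorphXn, mpolyC0, mpolyC1) /=.
  by ring.
have ot i : tnth (of_E4 v rho sigma tau) i \mPo to_E4 v rho sigma tau = (v ^+ 3)%:MP * 'X_i.
  elim/ord3P: i; rewrite {1}/tnth /= !(rmorphB, rmorphD, rmorphM, rmorphXn) /=;
    by rewrite ?[_%:MP \mPo _]comp_mpolyC !comp_mpolyX1 /tnth /=; ring.
have to i : tnth (to_E4 v rho sigma tau) i \mPo of_E4 v rho sigma tau = (v ^+ 3)%:MP * 'X_i.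
  elim/ord3P: i; rewrite {1}/tnth /= !(rmorphB, rmorphD, rmorphM, rmorphXn) /=;
    by rewrite ?[_%:MP \mPo _]comp_mpolyC !comp_mpolyX1 /tnth /=; ring.
have [tM tI] := linear_isomorphism (@to_E4_homog K v rho sigma tau)
  (@of_E4_homog K v rho sigma tau) v30 tE ot.
have [oM oI] := linear_isomorphism (@of_E4_homog K v rho sigma tau)
  (@to_E4_homog K v rho sigma tau) v30 oE to.
exists (to_E4 v rho sigma tau), (of_E4 v rho sigma tau); split=> //.
split; first by exists iY; rewrite /zero_pt eqxx oner_neq0.
have [fT _ _] := tM; exists (to_E4 v rho sigma tau); split=> //.
  by move=> i j; exists 0; rewrite mul0r mulrC subrr.
exists 1; first by rewrite oner_neq0.
apply: ord3P; rewrite /tnth /= !(evalxB, evalxM, evalxX) ?rmorphXn ?evalxC /zero_pt /=; ring.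
Qed.

End LinearMorphisms.

(** * Coordinate changes read off from pole orders *)

Lemma model_weq_at (K F : fieldType) (f : {rmorphism K -> F}) v rho sigma tau g X Y :
  weq_at (model v rho sigma tau g) f (f v ^+ 2 * X + f rho)
    (f v ^+ 3 * Y + f sigma * (f v ^+ 2 * X + f rho) + f tau) 1
  = f v ^+ 6 * weq_at (E4 g) f X Y 1.
Proof.
rewrite /weq_at /= !(rmorphB, rmorphD, rmorphN, rmorphMn, rmorphXn, rmorphM, rmorph0, rmorph1) /=.
ring.
Qed.

Section Shapes.
Variables (K F : fieldType) (E : weierstrass K) (f : {rmorphism K -> F}).
Variable xi : 'I_3 -> F.
Hypothesis gen : generic_point E f xi.

Lemma horner_size2 (P : {poly K}) x : (size P <= 2)%N ->
  (map_poly f P).[x] = f P`_1 * x + f P`_0.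
Proof.
move=> sP; rewrite (@horner_coef_wide _ 2) ?size_map_poly //.
by rewrite big_ord_recl big_ord1 !coef_map /= expr0 expr1 mulr1 addrC.
Qed.

Lemma pole2_shape a : pole E f xi a 2 -> exists al be, al != 0 /\ a = f al * xi iX + f be.
Proof.
move=> /poleW [P [Q [-> w]]]; move: w; rewrite weightE => w.
have sP : size P = 2 by slia.
have /eqP : size Q = 0%N by slia.
rewrite size_poly_eq0 => /eqP ->; exists P`_1, P`_0; split.
  by have := lead_coef_eq0 P; rewrite lead_coefE sP /= -size_poly_eq0 sP => ->.
by rewrite /reduced map_poly0 horner0 mul0r addr0 horner_size2 // sP.
Qed.

Lemma pole3_shape a : pole E f xi a 3 ->
  exists de ep ze, de != 0 /\ a = f de * xi iY + f ep * xi iX + f ze.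
Proof.
move=> /poleW [P [Q [-> w]]]; move: w; rewrite weightE => w.
have sP : (size P <= 2)%N by slia.
have sQ : size Q = 1%N by slia.
exists Q`_0, P`_1, P`_0; split.
  by have := lead_coef_eq0 Q; rewrite lead_coefE sQ /= -size_poly_eq0 sQ => ->.
rewrite /reduced horner_size2 // [in (map_poly f Q).[_]](size1_polyC (eq_leq sQ)).
by rewrite map_polyC hornerC /=; ring.
Qed.

(** The difference of the two equations has no y^2 term, so it has the form P + Q y and its
    coefficients vanish. *)
Lemma generic_weierstrass E' : weq_at E' f (xi iX) (xi iY) 1 = 0 -> E' = E.
Proof.
move=> e'; have [z1 e] := gen.1; move: e; rewrite evalx_weq z1 => e.
have [|/eqP ec /eqP el] := gen.2 (ycub E - ycub E') (ylin E' - ylin E).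
  rewrite /reduced !rmorphB /= !hornerD !hornerN !horner_ycub !horner_ylin.
  rewrite -[RHS](subrr 0) -{1}e' -e /weq_at; ring.
move: ec el; rewrite !subr_eq0 => /eqP ec /eqP el.
have coefc (E1 : weierstrass K) : ycub E1 = Poly [:: a6 E1; a4 E1; a2 E1; 1].
  by rewrite /ycub /= !cons_poly_def; ring.
have coefl (E1 : weierstrass K) : ylin E1 = Poly [:: a3 E1; a1 E1].
  by rewrite /ylin /= !cons_poly_def; ring.
have cc i := congr1 (fun P : {poly K} => P`_i) ec.
have cl i := congr1 (fun P : {poly K} => P`_i) el.
move: cc cl; rewrite !coefc !coefl => cc cl.
apply: weierstrass_eq.
- by have := cl 1%N; rewrite !coef_Poly.
- by have := cc 2%N; rewrite !coef_Poly.
- by have := cl 0%N; rewrite !coef_Poly.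
- by have := cc 1%N; rewrite !coef_Poly.
- by have := cc 0%N; rewrite !coef_Poly.
Qed.

Lemma affine_change_model al be de ep ze g : al != 0 -> de != 0 ->
    weq_at (E4 g) f (f al * xi iX + f be) (f de * xi iY + f ep * xi iX + f ze) 1 = 0 ->
  exists v rho sigma tau, v != 0 /\ E = model v rho sigma tau g.
Proof.
move=> al0 de0 eq.
(* P1 + P2 y is the equation of [E4 g] in the new coordinates, with y^2 eliminated through E. *)
pose P1 := (de ^+ 2)%:P * ycub E + (ep%:P * 'X + ze%:P) ^+ 2
  + (al%:P * 'X + be%:P) * (ep%:P * 'X + ze%:P) - (al%:P * 'X + be%:P) ^+ 3 - (g ^+ 4)%:P.
pose P2 := (de ^+ 2)%:P * - ylin E + (de%:P *+ 2) * (ep%:P * 'X + ze%:P)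
  + de%:P * (al%:P * 'X + be%:P).
have [|P10 _] := gen.2 P1 P2.
  have ysqr := affine_point_sqr gen.1; rewrite /reduced -[RHS]eq /P1 /P2 /weq_at /=.
  move: ysqr; move: (ycub E) (ylin E) => c l ysqr.
  rewrite !(rmorphB, rmorphD, rmorphM, rmorphN, rmorphMn, rmorphXn, rmorph0, rmorph1) /=.
  rewrite !map_polyC !map_polyX /=.
  rewrite !(hornerD, hornerN, hornerM, hornerMn, horner_exp, hornerC, hornerX).
  ring: ysqr.
have al_de : de ^+ 2 = al ^+ 3.
  apply/eqP; rewrite -subr_eq0; apply/eqP.
  have <- : P1`_3 = de ^+ 2 - al ^+ 3; last by rewrite P10 coef0.
  have -> : P1 = Poly [:: de ^+ 2 * a6 E + ze ^+ 2 + be * ze - be ^+ 3 - g ^+ 4;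
      de ^+ 2 * a4 E + ep * ze *+ 2 + al * ze + be * ep - al * be ^+ 2 *+ 3;
      de ^+ 2 * a2 E + ep ^+ 2 + al * ep - al ^+ 2 * be *+ 3; de ^+ 2 - al ^+ 3].
    rewrite /P1 /ycub /= !cons_poly_def !(polyCB, polyCD, polyCM, polyCN, polyCMn, rmorphXn) /=.
    ring.
  by rewrite coef_Poly.
(* As de^2 = al^3, this v satisfies v^2 al = v^3 de = 1, so inverting the change of coordinates
   gives the scaling of [model]. *)
pose v := al / de.
have v0 : v != 0 by rewrite mulf_neq0 ?invr_eq0.
have val : v ^+ 2 * al = 1 by rewrite /v exprMn mulrAC -exprSr -al_de -exprMn divff // expr1n.
have vde : v ^+ 3 * de = 1.
  by rewrite exprSr -mulrA (_ : v * de = al) // /v mulfVK.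
pose rho := - (v ^+ 2 * be); pose sigma := - (v ^+ 3 * ep); pose tau := - (v ^+ 3 * ze).
exists v, rho, sigma, tau; split=> //; symmetry; apply: generic_weierstrass.
have := model_weq_at f v rho sigma tau g (f al * xi iX + f be) (f de * xi iY + f ep * xi iX + f ze).
have <- : xi iX = f v ^+ 2 * (f al * xi iX + f be) + f rho.
  transitivity (f (v ^+ 2 * al) * xi iX); first by rewrite val rmorph1 mul1r.
  by rewrite /rho !(rmorphN, rmorphXn, rmorphM) /=; ring.
have <- : xi iY = f v ^+ 3 * (f de * xi iY + f ep * xi iX + f ze) + f sigma * xi iX + f tau.
  transitivity (f (v ^+ 3 * de) * xi iY); first by rewrite vde rmorph1 mul1r.
  by rewrite /sigma /tau !(rmorphN, rmorphXn, rmorphM) /=; ring.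
by rewrite eq mulr0.
Qed.

End Shapes.

Lemma isomorphic_model (K : fieldType) (E : weierstrass K) (g : K) : K_isomorphic E (E4 g) ->
  exists v rho sigma tau, v != 0 /\ E = model v rho sigma tau g.
Proof.
move=> [phi [chi [phiM chiM cp pc phi0]]].
have [F [f [xi gen]]] := generic_point_exists E.
have [eta [Eeta eX eY xX xY]] := coordinates_generate phiM chiM cp pc phi0 gen.
have [pX pY] := pole_eta gen Eeta eX eY xX xY.
have [al [be [al0 eXE]]] := pole2_shape pX.
have [de [ep [ze [de0 eYE]]]] := pole3_shape pY.
apply: (affine_change_model gen (be := be) (ep := ep) (ze := ze) al0 de0).
by rewrite -eXE -eYE -Eeta.1 -evalx_weq Eeta.2.
Qed.

Theorem corollary10p4 (K : fieldType) (charK : 2%N \in [pchar K])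
    (E : weierstrass K) (ellE : elliptic E) :
  (exists P : point K, on_curve E P /\ has_order E P 4)
  <-> (exists gamma : K, gamma != 0 /\ K_isomorphic E (E4 gamma)).
Proof.
split=> [[P [EP P4]]|[g [g0 /isomorphic_model [v [rho [sigma [tau [v0 ->]]]]]]]].
  have [v [rho [sigma [tau [g [v0 g0 ->]]]]]] := order4_model charK EP P4.
  by exists g; split=> //; apply: model_isomorphic.
exact: model_order4.
Qed.
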